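(* Suppose the constrained Markov decision process described in the context satisfies conditions (G), (SU) and (M) stated there. Then the following hold: (i) For any pair $(\pi,\zeta)\in\mathcal{S}$, there exists a stationary pair $(\bar\mu,\bar p)\in\Delta_s\cap\mathcal{S}$ with $J_i(\bar\mu,\bar p)\le J_i(\pi,\zeta)$ for all $i=0,\ldots,d$. (ii) There exists a stationary optimal pair $(\mu^*,p^* )\in\Delta_s\cap\mathcal{S}$. (iii) There exists a stationary lexicographically optimal pair $(\mu^*,p^* )\in\Delta_s\cap\mathcal{S}$.
   Context: MDP model. $\mathbb{X}$ (state space) is a Borel space, i.e., a separable metrizable space homeomorphic to a Borel subset of a Polish space. $\mathbb{A}$ (action space) is a countable set with the discrete topology. For a topological space $X$, $\mathcal{B}(X)$ is its Borel $\sigma$-algebra and $\mathcal{P}(X)$ the set of Borel probability measures; for $X$ a Borel space, $\mathcal{P}(X)$ carries the topology of weak convergence. Each $x\in\mathbb{X}$ has a nonempty set $A(x)\subset\mathbb{A}$ of admissible actions, and $\Gamma=\{(x,a): x\in\mathbb{X}, a\in A(x)\}$ is a Borel subset of $\mathbb{X}\times\mathbb{A}$. The state transition kernel $q(dy\,|\,x,a)$ is a Borel measurable stochastic kernel on $\mathbb{X}$ given $\mathbb{X}\times\mathbb{A}$ (i.e., a Borel measurable map into $\mathcal{P}(\mathbb{X})$). The one-stage cost functions $c_0,c_1,\ldots,c_d:\mathbb{X}\times\mathbb{A}\to[0,+\infty]$ are Borel measurable, finite on $\Gamma$ and equal to $+\infty$ outside $\Gamma$. $\kappa=(\kappa_1,\ldots,\kappa_d)\ge0$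 is a given vector of upper limits in $\mathbb{R}^d$. Policies and average costs. A policy is a sequence $\pi=(\mu_0,\mu_1,\ldots)$ where $\mu_n(da_n\,|\,x_0,a_0,\ldots,a_{n-1},x_n)$ is a Borel measurable stochastic kernel on $\mathbb{A}$ given $(\mathbb{X}\times\mathbb{A})^n\times\mathbb{X}$ with $\mu_n(A(x_n)\,|\,x_0,a_0,\ldots,a_{n-1},x_n)=1$ everywhere; $\Pi$ is the set of all policies. A stationary policy is one of the form $(\mu,\mu,\ldots)$ with $\mu(da\,|\,x)$ a Borel measurable stochastic kernel on $\mathbb{A}$ given $\mathbb{X}$ with $\mu(A(x)\,|\,x)=1$; it is denoted by $\mu$. A policy $\pi$ and an initial distribution $\zeta\in\mathcal{P}(\mathbb{X})$, together with $q$, determine the law of the process $\{(x_n,a_n)\}_{n\ge0}$, with expectation $\mathbf{E}^\pi_\zeta$. For $0\le i\le d$, $J_i(\pi,\zeta)=\limsup_{n\to\infty} n^{-1}\mathbf{E}^\pi_\zeta\big[\sum_{k=0}^{n-1}c_i(x_k,a_k)\big]$. A stationary pair is a pair $(\mu,p)$ of a stationary policy $\mu$ and $p\in\mathcal{P}(\mathbb{X})$ such that $p$ is an invariant probability measure of the Markov chain on $\mathbb{X}$ induced by $\mu$; $\Delta_s$ is the set of all stationary pairs. Constrained problem. The feasible set is $\mathcal{S}=\{(\pi,\zeta)\in\Pi\times\mathcal{P}(\mathbb{X}): J_0(\pi,\zeta)<\infty,\ J_i(\pi,\zeta)\le\kappa_i,\ i=1,\ldots,d\}$, and $\rho_c^*=\inf_{(\pi,\zeta)\in\mathcal{S}}J_0(\pi,\zeta)$.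 A pair $(\pi^*,\zeta^* )\in\Pi\times\mathcal{P}(\mathbb{X})$ is optimal if $(\pi^*,\zeta^* )\in\mathcal{S}$ and $J_0(\pi^*,\zeta^* )=\rho_c^*$. An optimal pair $(\pi^*,\zeta^* )$ is lexicographically optimal if for each $(\pi,\zeta)\in\mathcal{S}$, either $J_i(\pi^*,\zeta^* )=J_i(\pi,\zeta)$ for all $0\le i\le d$, or for some $\bar d\le d$, $J_i(\pi^*,\zeta^* )=J_i(\pi,\zeta)$ for all $i\le\bar d-1$ and $J_{\bar d}(\pi^*,\zeta^* )<J_{\bar d}(\pi,\zeta)$. A stationary (lexicographically) optimal pair is a stationary pair that is (lexicographically) optimal. Conditions. (G) $\mathcal{S}\ne\varnothing$. (SU) There is a nondecreasing sequence of compact sets $\Gamma_j\uparrow\Gamma$ such that for some $0\le i\le d$, $\lim_{j\to\infty}\inf_{(x,a)\in\Gamma_j^c}c_i(x,a)=+\infty$ (complement in $\mathbb{X}\times\mathbb{A}$). (M) With $\Gamma_j$ as in (SU), for each compact set $K\in\{\mathrm{proj}_{\mathbb{X}}(\Gamma_j)\}$ (projections of the $\Gamma_j$ on $\mathbb{X}$) there exist an open set $O\supset K$, a closed set $D\subset\mathbb{X}$ (possibly empty) and a finite measure $\nu$ on $\mathcal{B}(\mathbb{X})$, all possibly depending on $K$, such that $q\big((O\setminus D)\cap B\,|\,x,a\big)\le\nu(B)$ for all $B\in\mathcal{B}(\mathbb{X})$ and $(x,a)\in\Gamma$, and such that, restricted to $D\times\mathbb{A}$, the kernel $q(dy\,|\,x,a)$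 is continuous (as a map into $\mathcal{P}(\mathbb{X})$) and all the functions $c_i$, $0\le i\le d$, are lower semicontinuous. *)

(* Defs.v *)
From HB Require Import structures.
From mathcomp Require Import all_boot all_order all_algebra.
From mathcomp Require Import all_classical all_reals all_analysis.
From mathcomp Require Import measurable_realfun.
Import Order.TTheory GRing.Theory Num.Theory.
Import numFieldNormedType.Exports.

Set Implicit Arguments.
Unset Strict Implicit.
Unset Printing Implicit Defensive.

Local Open Scope classical_set_scope.
Local Open Scope ring_scope.
Local Open Scope ereal_scope.

(** Pointedness, inherited from the library's measurable types, only excludes
    the empty space, on which there is no probability measure. *)
HB.mixin Record isBorel d T & PointedTopological T & Measurable d T := {
  borelE : @measurable d T = <<s @open T >> }.

#[short(type="borelType")]
HB.structure Definition Borel d :=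
  {T of PointedTopological T & Measurable d T & isBorel d T}.

Definition separable (T : topologicalType) : Prop :=
  exists2 D : set T, countable D & dense D.

Definition homeomorphic_to_subset (T U : topologicalType) (B : set U) : Prop :=
  exists (f : T -> U) (g : U -> T),
    [/\ range f = B, cancel f g, continuous f & {within B, continuous g}].

Definition metrizable (R : realType) (T : topologicalType) : Prop :=
  exists M : metricType R, @homeomorphic_to_subset T M [set: M].

Definition complete_metric (R : realType) (M : metricType R) : Prop :=
  forall F : set_system M, ProperFilter F -> cauchy F ->
    exists x : M, F --> x.

Definition polish (R : realType) (T : topologicalType) : Prop :=
  separable T /\ exists M : metricType R,
    complete_metric M /\ @homeomorphic_to_subset T M [set: M].

Definition borel_space (R : realType) (T : topologicalType) : Prop :=
  [/\ separable T, metrizable R T &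
      exists (U : topologicalType) (B : set U),
        [/\ polish R U, <<s @open U >> B & homeomorphic_to_subset T B]].

Definition bounded_continuous (R : realType) (T : topologicalType) : Type :=
  {f : T -> R | continuous f /\ exists M : R, forall x, (`|f x| <= M)%R}.

Definition test_integrals (R : realType) d (T : borelType d)
    (P : probability T R) : {ptws bounded_continuous R T -> R} :=
  fun f => (\int[P]_x sval f x)%R.

Definition weak_probability (R : realType) d (T : borelType d) :
    topologicalType :=
  initial_topology (@test_integrals R d T).

Section kernel_point.
Context d1 d2 (T1 : measurableType d1) (T2 : measurableType d2) (R : realType).
Variable k : R.-pker T1 ~> T2.

Definition kernel_point (x : T1) : set T2 -> \bar R := k x.

HB.instance Definition _ x := Measure.on (kernel_point x).

HB.instance Definition _ x := Measure_isProbability.Build _ _ _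
  (kernel_point x) (prob_kernel (s := k) x).

End kernel_point.

Section kernel_preim.
Context d1 d2 d3 (T1 : measurableType d1) (T2 : measurableType d2)
  (T3 : measurableType d3) (R : realType).
Variables (k : R.-pker T2 ~> T3) (f : {mfun T1 >-> T2}).

Definition kernel_preim (x : T1) : {measure set T3 -> \bar R} := k (f x).

Let measurable_kernel_preim U : measurable U ->
  measurable_fun [set: T1] (kernel_preim ^~ U).
Proof.
move=> mU; apply: (@measurableT_comp _ _ _ _ _ _ (k ^~ U) _ f) => //.
exact: measurable_kernel.
Qed.

HB.instance Definition _ := isKernel.Build _ _ _ _ _ kernel_preim
  measurable_kernel_preim.

Let kernel_preim_prob x : kernel_preim x [set: T3] = 1.
Proof. exact: prob_kernel. Qed.

HB.instance Definition _ := Kernel_isProbability.Build _ _ _ _ _ kernel_preim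
  kernel_preim_prob.

End kernel_preim.

(** The law of [(t, u)] when [t] has law [P] and [u] has conditional law
    [k t] given [t]. *)
Section semidirect.
Context d1 d2 (T1 : measurableType d1) (T2 : measurableType d2) (R : realType).
Variables (P : probability T1 R) (k : R.-pker T1 ~> T2).

Definition semidirect (B : set (T1 * T2)) : \bar R :=
  \int[P]_t k t (xsection B t).

Let semidirect0 : semidirect set0 = 0.
Proof. by apply: integral0_eq => t _; rewrite xsection0 measure0. Qed.

Let semidirect_ge0 B : 0 <= semidirect B.
Proof. exact: integral_ge0. Qed.

Let semidirect_sigma_additive : semi_sigma_additive semidirect.
Proof.
move=> F mF tF mUF; rewrite [X in _ --> X](_ : _ =
    \int[P]_t (\sum_(n <oo) k t (xsection (F n) t))).
  apply/cvg_closeP; split.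
    by apply: is_cvg_nneseries => n _ _; exact: integral_ge0.
  rewrite closeE// integral_nneseries// => n.
  by apply: measurable_fun_xsection_finite_kernel; rewrite inE.
apply: eq_integral => t _; apply/esym/cvg_lim => //.
rewrite xsection_bigcup; apply: measure_semi_sigma_additive.
- by move=> n; exact: measurable_xsection.
- exact: trivIset_xsection.
- by rewrite -xsection_bigcup; exact: measurable_xsection.
Qed.

HB.instance Definition _ := isMeasure.Build _ _ _ semidirect
  semidirect0 semidirect_ge0 semidirect_sigma_additive.

Let semidirect_prob : semidirect [set: T1 * T2] = 1.
Proof.
rewrite /semidirect (eq_integral (cst 1)).
  by rewrite integral_cst// mul1e; exact: probability_setT.
move=> t _; rewrite (_ : xsection _ _ = [set: T2]) ?prob_kernel//.
by apply/seteqP; split => // y _; rewrite /xsection/= inE.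
Qed.

HB.instance Definition _ := Measure_isProbability.Build _ _ _
  semidirect semidirect_prob.

End semidirect.

(** The pair of [(x_0, a_0), .., (x_{n-1}, a_{n-1})] and [x_n]. *)
Notation history X A n := (n.-tuple (X * A)%type * X)%type.

Section histories.
Context dX dA (X : measurableType dX) (A : measurableType dA).

Definition history_state n (h : history X A n) : X := h.2.

Lemma measurable_history_state n : measurable_fun setT (@history_state n).
Proof. exact: measurable_snd. Qed.

HB.instance Definition _ n :=
  isMeasurableFun.Build _ _ _ _ (@history_state n) (@measurable_history_state n).

Definition history0 (x : X) : history X A 0 := ([tuple], x).

Lemma measurable_history0 : measurable_fun setT history0.
Proof.
by apply: measurable_fun_pair; [exact: measurable_cst|exact: measurable_id].
Qed.

HB.instance Definition _ :=
  isMeasurableFun.Build _ _ _ _ history0 measurable_history0.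

Definition last_pair n (z : history X A n * A) : X * A := (z.1.2, z.2).

Lemma measurable_last_pair n : measurable_fun setT (@last_pair n).
Proof.
apply: measurable_fun_pair; last exact: measurable_snd.
exact: (measurableT_comp measurable_snd measurable_fst).
Qed.

HB.instance Definition _ n :=
  isMeasurableFun.Build _ _ _ _ (@last_pair n) (@measurable_last_pair n).

Definition history_extend n (w : history X A n * A * X) : history X A n.+1 :=
  ([tuple of rcons w.1.1.1 (last_pair w.1)], w.2).

Lemma measurable_history_extend n : measurable_fun setT (@history_extend n).
Proof.
apply: measurable_fun_pair; last exact: measurable_snd.
apply/measurable_fun_tnthP => i.
have [ltin|lein] := ltnP i n.
- rewrite (_ : _ \o _ = (fun h : n.-tuple (X * A) => tnth h (Ordinal ltin)) \o
      (fst \o (fst \o fst))); last first.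
    apply/funext => -[[[h x] a] y] /=.
    by rewrite !(tnth_nth (x, a))/= nth_rcons size_tuple ltin.
  apply: measurableT_comp; first exact: measurable_tnth.
  apply: measurableT_comp; first exact: measurable_fst.
  by apply: measurableT_comp; exact: measurable_fst.
- rewrite (_ : _ \o _ = @last_pair n \o fst); last first.
    apply/funext => -[[[h x] a] y] /=.
    rewrite (tnth_nth (x, a))/= nth_rcons size_tuple ltnNge lein/=.
    by rewrite eqn_leq lein -ltnS ltn_ord.
  by apply: measurableT_comp; [exact: measurable_last_pair|exact: measurable_fst].
Qed.

HB.instance Definition _ n :=
  isMeasurableFun.Build _ _ _ _ (@history_extend n)
    (@measurable_history_extend n).

End histories.

(** Since the action space is countable and discrete, the product
    sigma-algebra on [X * A] is the Borel sigma-algebra of the product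
    topology.  For the separable metrizable space [X], kernels into [X] in the
    sense of the library are the Borel measurable maps into the space of
    probability measures with the weak topology. *)
Record cmdp (R : realType) dX dA (X : borelType dX) (A : borelType dA)
    (d : nat) := CMDP {
  state_borel : borel_space R X;
  action_countable : countable [set: A];
  action_discrete : forall B : set A, open B;
  admissible : X -> set A;
  admissible_neq0 : forall x, admissible x !=set0;
  admissible_graph := [set z : X * A | admissible z.1 z.2];
  measurable_admissible_graph : measurable admissible_graph;
  transition : R.-pker (X * A) ~> X;
  cost : 'I_d.+1 -> X * A -> \bar R;
  cost_ge0 : forall i z, 0 <= cost i z;
  measurable_cost : forall i, measurable_fun [set: X * A] (cost i);
  cost_fin : forall i z, admissible_graph z -> cost i z \is a fin_num;
  cost_infty : forall i z, ~ admissible_graph z -> cost i z = +oo;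
  kappa : 'I_d -> R;
  kappa_ge0 : forall i, (0 <= kappa i)%R }.

Section cmdp_theory.
Context (R : realType) dX dA (X : borelType dX) (A : borelType dA) (d : nat).
Variable M : cmdp R X A d.

Record policy := Policy {
  policy_kernel : forall n, R.-pker (history X A n) ~> A;
  policy_admissible : forall n (h : history X A n),
    policy_kernel n h (admissible M h.2) = 1 }.

Record stationary_policy := StationaryPolicy {
  stationary_kernel : R.-pker X ~> A;
  stationary_admissible : forall x,
    stationary_kernel x (admissible M x) = 1 }.

Definition policy_of_stationary (mu : stationary_policy) : policy :=
  @Policy
    (fun n => kernel_preim (stationary_kernel mu) (@history_state _ _ X A n))
    (fun n h => stationary_admissible mu h.2).

(** The law of the history of length [n] under the policy [pi] and the initial
    distribution [zeta].  It determines the expected cost of the first [n]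
    stages, so the law of the infinite process is not needed. *)
Fixpoint history_law (pi : policy) (zeta : probability X R) (n : nat) :
    probability (history X A n) R :=
  if n is m.+1 then
    distribution
      (semidirect (semidirect (history_law pi zeta m) (policy_kernel pi m))
        (kernel_preim (transition M) (@last_pair _ _ X A m)))
      (@history_extend _ _ X A m)
  else distribution zeta (@history0 _ _ X A).

Definition average_cost (i : 'I_d.+1) (pi : policy) (zeta : probability X R) :
    \bar R :=
  limn_esup (fun n => (n%:R^-1)%:E *
    \int[history_law pi zeta n]_h \sum_(k < n) cost M i (tnth h.1 k)).

Definition invariant_probability (mu : stationary_policy)
    (p : probability X R) : Prop :=
  forall B : set X, measurable B ->
    \int[p]_x (kcomp (stationary_kernel mu) (transition M) x B) = p B.

Definition stationary_pairs : set (stationary_policy * probability X R) :=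
  [set z | invariant_probability z.1 z.2].

Definition feasible : set (policy * probability X R) :=
  [set z | average_cost ord0 z.1 z.2 < +oo /\
    forall i : 'I_d, average_cost (lift ord0 i) z.1 z.2 <= (kappa M i)%:E].

Definition optimal_value : \bar R :=
  ereal_inf [set average_cost ord0 z.1 z.2 | z in feasible].

Definition optimal (z : policy * probability X R) : Prop :=
  feasible z /\ average_cost ord0 z.1 z.2 = optimal_value.

Definition lex_optimal (z : policy * probability X R) : Prop :=
  optimal z /\ forall w, feasible w ->
    (forall i, average_cost i z.1 z.2 = average_cost i w.1 w.2) \/
    (exists i : 'I_d.+1,
      (forall j : 'I_d.+1, (j < i)%N ->
        average_cost j z.1 z.2 = average_cost j w.1 w.2) /\
      average_cost i z.1 z.2 < average_cost i w.1 w.2).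

Definition conditionG : Prop := feasible !=set0.

(** The infimum over the empty set is [+oo]. *)
Definition conditionSU (Gam : nat -> set (X * A)) : Prop :=
  [/\ {homo Gam : m n / (m <= n)%N >-> m `<=` n},
      \bigcup_j Gam j = admissible_graph M,
      forall j, compact (Gam j) &
      exists i : 'I_d.+1,
        ereal_inf [set cost M i z | z in ~` Gam j] @[j --> \oo] --> +oo].

(** The points outside [E] are isolated in [subspace E], so that lower
    semicontinuity on it is that of the restriction to [E]. *)
Definition conditionM (Gam : nat -> set (X * A)) : Prop :=
  forall j, exists (O D : set X) (nu : {finite_measure set X -> \bar R}),
    [/\ open O, fst @` Gam j `<=` O, closed D,
        forall B z, measurable B -> admissible_graph M z ->
          transition M z ((O `\` D) `&` B) <= nu B &
        {within D `*` [set: A], continuous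
          (fun z : X * A =>
            kernel_point (transition M) z : weak_probability R X)} /\
        forall i, lower_semicontinuous
          (cost M i : subspace (D `*` [set: A]) -> \bar R)].

End cmdp_theory.

(* Main.v *)
From HB Require Import structures.
From mathcomp Require Import all_boot all_order all_algebra.
From mathcomp Require Import all_classical all_reals all_analysis.
From mathcomp Require Import measurable_realfun.
From mathcomp Require Import lra.
Require Import Defs.

(** The occupation measures of a feasible pair have a limit that is itself the
    occupation measure of a stationary pair, and passing to the limit does not
    increase any of the costs; this gives the first claim. Limits of stationary
    pairs are again stationary pairs, for the same reason, so the costs can be
    minimized one after the other over stationary pairs
    ([lexicographic_minimum]), which gives the other two.

    Let [g n] be probability measures on state-action pairs for which a
    transition changes the law of the state very little: the averages of the
    laws of [(x_k, a_k)] over the first [n.+1] stages, or the laws of stationary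
    pairs. Along an ultrafilter the numbers [g n B] converge for all measurable
    [B] simultaneously, to a finitely additive [m]. The strictly unbounded cost
    makes [m] tight, so the outer measure that the values of [m] on open sets
    generate is a probability measure [P] on measurable sets, at most [m] on
    open sets and at least [m] on closed sets ([tight_content_probability]).

    The costs and the transition kernel are semicontinuous or continuous only
    over the closed set [D]. Off [D], near a compact set, the majorizing measure
    dominates [m], which is therefore countably additive there and equal to [P]
    ([dominated_limit_eq]). If [G] agrees over [D] with an open set [W], then
    [P W <= m W], and exchanging the parts of [W] and [G] off [D] yields
    [P G <= m G] ([limit_le_relatively_open]). The superlevel sets of a function
    [f] that is lower semicontinuous over [D] are such sets [G]. As the integral
    of [f] is determined by the measures of these sets, an eventual bound on the
    integrals of [f] for [g n] passes to [P] ([near_limit_integral_le]).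

    For the costs this says that the limit increases none of them. For the
    integral of a continuous [v] after one transition, and for [1 - v], it gives
    the invariance of the state marginal of [P] ([limit_next_law]). Finally [P]
    is disintegrated into its state marginal and a stationary policy
    ([disintegration]); an admissible action is chosen measurably where the
    conditional law is not determined. *)

Import Order.TTheory GRing.Theory Num.Theory.
Import numFieldNormedType.Exports.

Set Implicit Arguments.
Unset Strict Implicit.
Unset Printing Implicit Defensive.

Local Open Scope classical_set_scope.
Local Open Scope ring_scope.
Local Open Scope ereal_scope.

(** * Continuous functions detecting open sets *)

HB.instance Definition _ (S T : ptopologicalType) := Pointed.on (S * T)%type.

(** This is what remains of a metric below: the function [phi] plays the role
    of the distance to the complement of [V], and it survives a product with a
    discrete space. *)
Definition perfectly_normal (R : realType) (T : topologicalType) : Prop :=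
  forall V : set T, open V -> exists phi : T -> R,
    [/\ continuous phi, forall x, (0 <= phi x <= 1)%R &
        V = [set x | (0 < phi x)%R]].

Lemma continuous_contract (R : realType) :
  continuous (@contract R : \bar R -> R).
Proof.
move=> x; apply/cvgrPdist_lt => e e0.
have := @nbhsx_ballx _ (\bar R) x _ e0.
by apply: filterS => y.
Qed.

(** The distance to the complement may be infinite; [contract] brings it into
    the unit interval. *)
Lemma metrizable_perfectly_normal (R : realType) (T : topologicalType) :
  metrizable R T -> perfectly_normal R T.
Proof.
move=> [M [f [g [rf fK cf cg]]]] V oV.
have cg' : continuous g by apply/continuous_subspace_setT.
have gK x : f (g x) = x.
  have : range f x by rewrite rf.
  by move=> [y _ <-]; rewrite fK.
pose C := ~` (g @^-1` V).
exists (fun x => contract (edist_inf C (f x))); split.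
- move=> x; apply: (@continuous_comp _ _ _ (edist_inf C \o f) (@contract R)).
    by apply: continuous_comp; [exact: cf|exact: edist_inf_continuous].
  exact: continuous_contract.
- move=> x; apply/andP; split;
  last exact: le_trans (ler_norm _) (contract_le1 _).
  by rewrite -(@contract0 R) le_contract edist_inf_ge0.
- apply/seteqP; split => x /=.
  + move=> Vx; rewrite -(@contract0 R) lt_contract.
    have : nbhs (f x) (g @^-1` V).
      by apply: cg'; rewrite fK; exact: open_nbhs_nbhs.
    move=> /(@nbhs_ballP _ M)[e/= e0 eV].
    apply: (@lt_le_trans _ _ e%:E); first by rewrite lte_fin.
    apply: le_ereal_inf_tmp => _ [y /= Cy <-].
    rewrite leNgt; apply/negP => /edist_lt_ball/= bxy.
    by apply: Cy; exact: eV.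
  + rewrite -(@contract0 R) lt_contract => p; apply: contrapT => nV.
    by move: p; rewrite edist_inf0 ?ltxx//= /C/= fK.
Qed.

Lemma open_slice (T A : topologicalType) (V : set (T * A)) a :
  open V -> open [set x | V (x, a)].
Proof.
move=> oV; apply: (@open_comp _ _ (fun x : T => (x, a))) => // x _.
by apply: cvg_pair => //=; exact: cvg_cst.
Qed.

Lemma discrete_prod_perfectly_normal (R : realType) (T A : topologicalType) :
  (forall B : set A, open B) -> perfectly_normal R T ->
  perfectly_normal R (T * A)%type.
Proof.
move=> dA pT V oV.
have /choice[phi phiP] := fun a => pT _ (open_slice a oV).
exists (fun z => phi z.2 z.1); split.
- move=> [x a]; rewrite /continuous_at/=.
  apply/cvgrPdist_lt => e e0.
  have [cphi _ _] := phiP a.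
  have /cvgrPdist_lt/(_ _ e0) xe := cphi x.
  exists ([set t | (`|phi a x - phi a t| < e)%R], [set a]) => /=.
    by split => //; apply: open_nbhs_nbhs; split.
  by move=> [y b]/= [ye ->].
- by move=> [x a]/=; have [_ + _] := phiP a; exact.
- apply/seteqP; split => -[x a]/=.
    by move=> Vxa; have [_ _] := phiP a => /seteqP[+ _]; exact.
  by have [_ _] := phiP a => /seteqP[_]; exact.
Qed.

(** * The outer measure of a finitely additive function of open sets *)

Section open_content.
Context (R : realType) (T : ptopologicalType) (m : set T -> \bar R).

(** Only the values on open sets matter, and only finite additivity is asked
    for: this is what a limit of measures along an ultrafilter retains. *)
Record open_content : Prop := OpenContent {
  open_content0 : m set0 = 0;
  open_content_ge0 : forall V, open V -> 0 <= m V;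
  le_open_content : forall V W, open V -> open W -> V `<=` W -> m V <= m W;
  open_contentU_ge : forall V W, open V -> open W -> V `&` W = set0 ->
    m V + m W <= m (V `|` W);
  open_contentU_le : forall V W, open V -> open W ->
    m (V `|` W) <= m V + m W;
  open_content_lty : m setT < +oo }.

(** Covers that use a set that is not open have infinite weight, so the outer
    measure generated by these weights is the infimum over open covers. *)
Definition open_weight (V : set (g_sigma_algebraType (@open T))) : \bar R :=
  if `[< open (V : set T) >] then m V else +oo.

Definition open_outer : set T -> \bar R := mu_ext open_weight.

Hypothesis mP : open_content.

Let w_ge0 V : 0 <= open_weight V.
Proof.
by rewrite /open_weight; case: asboolP => // oV; exact: open_content_ge0.
Qed.

Let w0 : open_weight set0 = 0.
Proof. by rewrite /open_weight asboolT ?open_content0//; exact: open0. Qed.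

Let wE V : open V -> open_weight V = m V.
Proof. by move=> oV; rewrite /open_weight asboolT. Qed.

HB.instance Definition _ := isOuterMeasure.Build R T open_outer
  (mu_ext0 w0 w_ge0) (mu_ext_ge0 w_ge0) (@le_mu_ext _ _ _ open_weight)
  (mu_ext_sigma_subadditive w_ge0).

Definition open_outer_measure : {outer_measure set T -> \bar R} := open_outer.

Lemma open_outer_le V : open V -> open_outer V <= m V.
Proof.
move=> oV; apply: ereal_inf_lbound.
(* The cover by [V] alone. *)
exists (fun n => if n is 0%N then V else set0).
  split; last by move=> x Vx; exists 0%N.
  by move=> [|n] /=; [exact: sub_sigma_algebra|exact: measurable0].
rewrite (@nneseriesD1 _ _ 0%N)//= eseries0 ?adde0 ?wE//.
by move=> [|n]//= _ _.
Qed.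

Lemma open_outer_ge (K : set T) c : (forall F : (set T)^nat,
    (forall n, open (F n)) -> K `<=` \bigcup_n F n ->
    c <= \sum_(n <oo) m (F n)) ->
  c <= open_outer K.
Proof.
move=> cK; apply: le_ereal_inf_tmp => _ [F [_ KF] <-].
have [oF|/existsNP[n nF]] := pselect (forall n, open (F n : set T)).
  rewrite (eq_eseriesr (g := m \o F)); first exact: cK.
  by move=> n _; rewrite /= wE.
rewrite (@eseries_pinfty _ _ _ n) ?leey// => [k _|].
  by rewrite -ltNye (lt_le_trans _ (w_ge0 _)).
by rewrite /open_weight asboolF.
Qed.

Lemma open_content_bigcup (F : (set T)^nat) n : (forall n, open (F n)) ->
  m (\big[setU/set0]_(i < n) F i) <= \sum_(i < n) m (F i).
Proof.
move=> oF; elim: n => [|n ih]; first by rewrite !big_ord0 open_content0.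
rewrite !big_ord_recr/=; apply: le_trans.
  apply: open_contentU_le => //.
  by rewrite -bigcup_mkord; apply: bigcup_open => i _; exact: oF.
by rewrite leeD2r.
Qed.

(** A countable open cover of a compact set has a finite subcover, for which
    finite subadditivity is enough. *)
Lemma open_outer_compact (K : set T) c : compact K ->
    (forall V, open V -> K `<=` V -> c <= m V) ->
  c <= open_outer K.
Proof.
move=> + cV; rewrite compact_cover => cK.
apply: open_outer_ge => F oF KF.
have [D _ KD] := cK nat setT F (fun i _ => oF i) KF.
pose n := (\max_(i <- finmap.enum_fset D) i).+1.
have oU : open (\big[setU/set0]_(i < n) F i).
  by rewrite -bigcup_mkord; apply: bigcup_open => i _; exact: oF.
apply: (@le_trans _ _ (m (\big[setU/set0]_(i < n) F i))).
  apply: cV => // x /KD[i /= iD Fix]; rewrite -bigcup_mkord; exists i => //=.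
  by rewrite /n ltnS; apply: (@leq_bigmax_seq _ _ xpredT id i).
apply: (le_trans (open_content_bigcup n oF)).
rewrite -(big_mkord xpredT (m \o F)); apply: nneseries_lim_ge => k _ _.
exact: open_content_ge0.
Qed.

Section cozero_caratheodory.
Variable phi : T -> R.
Hypothesis cphi : continuous phi.

Let above n := [set x | (n.+1%:R^-1 < phi x)%R].
Let below n := [set x | (phi x < n.+1%:R^-1)%R].
Let ring n := below n `&` above n.+2.

Let open_above n : open (above n).
Proof.
rewrite (_ : above n = phi @^-1` `](n.+1%:R^-1)%R, +oo[).
  by apply: open_comp => [x _|]; [exact: cphi|exact: interval_open].
by apply/seteqP; split => x /=; rewrite in_itv/= andbT.
Qed.

Let open_below n : open (below n).
Proof.
rewrite (_ : below n = phi @^-1` `]-oo, (n.+1%:R^-1)%R[).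
  by apply: open_comp => [x _|]; [exact: cphi|exact: interval_open].
by apply/seteqP; split => x /=; rewrite in_itv/=.
Qed.

Let open_ring n : open (ring n).
Proof. exact: openI. Qed.

Let above_sub n k : (n <= k)%N -> above n `<=` above k.
Proof.
move=> nk x /=; apply: le_lt_trans.
by rewrite lef_pV2 ?posrE ?ltr0Sn// ler_nat.
Qed.

(** Two consecutive rings overlap, but [ring n] is disjoint from [above n] and
    both lie in [above n.+2]. *)
Let sum_ring n :
  \sum_(i < n) m (ring i) <= m (above n) + m (above n.+1).
Proof.
elim: n => [|n ih].
  by rewrite big_ord0 adde_ge0//; apply: open_content_ge0.
rewrite big_ord_recr/=; apply: (le_trans (leeD2r _ ih)).
rewrite [X in X + _]addeC -addeA leeD2l//.
apply: le_trans.
  apply: open_contentU_ge => //.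
  by apply/seteqP; split => // x [/= h [h' _]]; have := lt_trans h h';
    rewrite ltxx.
apply: le_open_content => //; first exact: openU.
by move=> x [|[]//]; apply: above_sub; rewrite -addn2 leq_addr.
Qed.

Let ring_summable : \sum_(n <oo) m (ring n) < +oo.
Proof.
apply: (@le_lt_trans _ _ (m setT + m setT)); last first.
  by rewrite lte_add_pinfty// open_content_lty.
apply: lime_le.
  by apply: is_cvg_nneseries => n _ _; exact: open_content_ge0.
near=> n; rewrite big_mkord; apply: (le_trans (sum_ring n)).
by apply: leeD; apply: le_open_content => //; exact: openT.
Unshelve. all: by end_near. Qed.

(** If [phi x] is at most [n.+2%:R^-1], the integer part [k] of its inverse is
    at least [n.+2], and [x] lies in the ring of index [k - 2]. *)
Let cover_above n : [set x | (0 < phi x)%R] `<=`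
  above n.+1 `|` \bigcup_(k in ~` `I_n) ring k.
Proof.
move=> x /= px; have [?|xn] := ltP (n.+2%:R^-1)%R (phi x); [by left|right].
pose k := Num.truncn (phi x)^-1.
have p1 : (0 <= (phi x)^-1)%R by rewrite invr_ge0 ltW.
have := truncn_itv p1; rewrite -/k => /andP[k1 k2].
have nk : (n.+2 <= k)%N.
  rewrite /k truncn_ge_nat//.
  by rewrite -[leLHS]invrK lef_pV2// ?posrE// invr_gt0 ltr0n.
exists k.-2 => /=.
  by rewrite /= -/(~ _); apply/negP; rewrite -leqNgt;
    case: k nk {k1 k2} => [|[]].
have k0 : (0 < k.-2.+1%:R :> R)%R by rewrite ltr0n.
case: k nk k1 k2 k0 => [|[|k]]//= nk k1 k2 k0; split => /=.
- rewrite /below/= -[ltLHS]invrK ltf_pV2 ?posrE ?invr_gt0//.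
  by apply: lt_le_trans k1; rewrite ltr_nat.
- by rewrite /above/= -[ltRHS]invrK ltf_pV2 ?posrE ?invr_gt0// ltr0n.
Qed.

Let outer_split_open (G : set T) : open G ->
  open_outer (G `&` [set x | (0 < phi x)%R]) +
  open_outer (G `&` ~` [set x | (0 < phi x)%R]) <= m G.
Proof.
move=> oG; set V := [set x | (0 < phi x)%R].
have mGfin : m G \is a fin_num.
  rewrite ge0_fin_numE ?open_content_ge0//.
  apply: le_lt_trans (open_content_lty mP).
  by apply: le_open_content => //; exact: openT.
have tail : m G + \sum_(n <= k <oo) m (ring k) @[n --> \oo] --> m G + 0.
  apply: cvgeD; [exact: fin_num_adde_defl|exact: cvg_cst|].
  apply: nneseries_tail_cvg; first exact: ring_summable.
  by move=> k _; exact: open_content_ge0.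
(* The part of [G] in [above n.+1] and a neighbourhood of the part outside [V]
   are disjoint open subsets of [G]; the rings from [n] on cover the rest. *)
rewrite -[m G]adde0; apply: (cvge_ge _ tail) => //.
near=> n.
apply: (@le_trans _ _ (open_outer (G `&` above n.+1) +
    \sum_(n <= k <oo) m (ring k) + open_outer (G `&` ~` V))).
  rewrite leeD2r//; apply: (@le_trans _ _ (open_outer (G `&` above n.+1) +
      open_outer (\bigcup_(k in ~` `I_n) ring k))).
    apply: le_trans (outer_measureU2 _ _ _); apply: le_outer_measure.
    by move=> x [Gx /(cover_above n)[]]; [left|right].
  rewrite leeD2l//; apply: le_trans.
    exact: outer_measure_sigma_subadditive_tail.
  apply: lee_nneseries => [k _ _|k _]; first exact: outer_measure_ge0.
  exact: open_outer_le.
rewrite addeAC leeD2r//.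
apply: (@le_trans _ _ (m (G `&` above n.+1) + m (G `&` below n.+1))).
  apply: leeD; first by apply: open_outer_le; exact: openI.
  apply: le_trans (open_outer_le _); last exact: openI.
  apply: le_outer_measure => x [Gx /negP]; rewrite -leNgt => x0; split => //=.
  by apply: le_lt_trans x0 _; rewrite invr_gt0 ltr0n.
apply: le_trans (open_contentU_ge mP (openI oG (open_above _))
    (openI oG (open_below _)) _) _.
  apply/seteqP; split => // x [[_ /= h] [_ /= h']].
  by have := lt_trans h h'; rewrite ltxx.
apply: le_open_content => //; first by apply: openU; exact: openI.
by move=> x [[]|[]].
Unshelve. all: by end_near. Qed.

(** The rings where [phi] is between [n.+3%:R^-1] and [n.+1%:R^-1] carry a
    convergent series of contents, so that [phi > 0] is exhausted by sets at a
    positive distance from its complement; this is the argument for metric outer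
    measures. *)
Lemma cozero_caratheodory :
  open_outer.-caratheodory [set x | (0 < phi x)%R].
Proof.
apply: le_caratheodory_measurable => X; set V := [set x | (0 < phi x)%R].
apply: open_outer_ge => F oF XF.
apply: (@le_trans _ _ (\sum_(n <oo) (open_outer (F n `&` V) +
    open_outer (F n `&` ~` V)))); last first.
  apply: lee_nneseries => [n _ _|n _]; last exact: outer_split_open.
  by rewrite adde_ge0// outer_measure_ge0.
rewrite nneseriesD; [|by move=> *; rewrite outer_measure_ge0..].
by apply: leeD; (apply: le_trans; last exact: outer_measure_sigma_subadditive);
  apply: le_outer_measure; rewrite -setI_bigcupl; exact: setSI.
Qed.

End cozero_caratheodory.

End open_content.

(** * Setwise limits along an ultrafilter and tightness *)

Lemma ultra_cvg_unit (R : realType) (U : set_system nat) (u : nat -> R) :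
  UltraFilter U -> (forall n, 0 <= u n <= 1)%R -> exists l : R, u n @[n --> U]
    --> l.
Proof.
move=> UU u01; have UP : ProperFilter U by exact: ultra_proper.
have [F [FU UF]] : exists F, UltraFilter F /\ u n @[n --> U] `<=` F.
  exact: ultraFilterLemma.
have := @segment_compact R 0 1; rewrite compact_ultra => /(_ F FU)[].
  by apply: UF; apply: (@filterE _ U) => n /=; rewrite in_itv/=; exact: u01.
move=> l [_ /= Fl]; exists l; apply: cvg_trans Fl => E FE.
have [//|UE] := in_ultra_setVsetC (fun n => E (u n)) UU.
have FnE : F (~` E) by exact: UF.
by have [x []] := filter_ex (filterI FE FnE).
Qed.

Section setwise_limit.
Context d (T : measurableType d) (R : realType).

Record probability_content (m : set T -> R) : Prop := ProbabilityContent {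
  contentT : m setT = 1%R;
  content_ge0 : forall B, measurable B -> (0 <= m B)%R;
  contentU : forall B C, measurable B -> measurable C -> B `&` C = set0 ->
    m (B `|` C) = (m B + m C)%R }.

Definition setwise_limit (U : set_system nat) (g : nat -> probability T R)
    (m : set T -> R) : Prop :=
  forall B, measurable B -> fine (g n B) @[n --> U] --> m B.

Lemma probability_fine (P : probability T R) B : measurable B ->
  P B = (fine (P B))%:E.
Proof. by move=> mB; rewrite fineK// fin_num_measure. Qed.

(** An ultrafilter makes all the sequences [g n B] converge at once, which no
    subsequence does for uncountably many sets [B]. *)
Lemma ultra_setwise_limit (U : set_system nat) (g : nat -> probability T R) :
  UltraFilter U -> exists m, setwise_limit U g m.
Proof.
move=> UU; have UP : ProperFilter U by exact: ultra_proper.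
suff /choice[m mP] : forall B, exists l : R, measurable B ->
    fine (g n B) @[n --> U] --> l by exists m => B; exact: mP.
move=> B; have [mB|nB] := pselect (measurable B); last by exists 0%R.
have [|l ul] := ultra_cvg_unit UU (u := fun n => fine (g n B));
  last by exists l.
move=> n; rewrite fine_ge0//= -lee_fin -probability_fine//.
exact: probability_le1.
Qed.

Section limit_content.
Context (U : set_system nat) (g : nat -> probability T R) (m : set T -> R).
Hypotheses (UP : ProperFilter U) (gm : setwise_limit U g m).

Lemma setwise_limit_content : probability_content m.
Proof.
split.
- apply: (cvg_unique (@Rhausdorff R) (gm measurableT)).
  rewrite /= (_ : (fun n => _) = cst 1%R); first exact: cvg_cst.
  by apply/funext => n; rewrite probability_setT.
- move=> B mB; apply: (ler_cvg_to (cvg_cst 0%R) (gm mB)).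
  by apply: nearW => n; rewrite fine_ge0.
- move=> B C mB mC BC0.
  apply: (cvg_unique (@Rhausdorff R) (gm (measurableU _ _ mB mC))).
  rewrite /= (_ : (fun n => _) = (fun n => fine (g n B) + fine (g n C))%R).
    exact: cvgD (gm mB) (gm mC).
  apply/funext => n; rewrite measureU// fineD// fin_num_measure//.
Qed.

End limit_content.

Section content_theory.
Context (m : set T -> R) (mP : probability_content m).

Lemma le_content B C : measurable B -> measurable C -> B `<=` C ->
  (m B <= m C)%R.
Proof.
move=> mB mC BC; rewrite -(setDUK BC) contentU//; last 2 first.
  exact: measurableD.
  by rewrite setDE setICA setICr setI0.
by rewrite lerDl content_ge0//; exact: measurableD.
Qed.

Lemma contentID B C : measurable B -> measurable C ->
  m B = (m (B `&` C) + m (B `\` C))%R.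
Proof.
move=> mB mC; rewrite -contentU//; [|exact: measurableI|exact: measurableD|].
  by rewrite setUIDK.
by rewrite setDE setIACA setICr setI0.
Qed.

Lemma content0 : m set0 = 0%R.
Proof.
by apply: (@addrI _ (m set0)); rewrite -contentU// ?setU0 ?addr0// setI0.
Qed.

Lemma contentC B : measurable B -> m (~` B) = (1 - m B)%R.
Proof.
move=> mB; rewrite -(contentT mP) (contentID measurableT mB) setTI setTD.
by rewrite addrAC subrr add0r.
Qed.

Lemma contentU_le B C : measurable B -> measurable C ->
  (m (B `|` C) <= m B + m C)%R.
Proof.
move=> mB mC; rewrite (contentID (measurableU _ _ mB mC) mB).
rewrite setUK lerD2l; apply: le_content => //.
  by apply: measurableD => //; exact: measurableU.
by move=> x [[]].
Qed.

End content_theory.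

End setwise_limit.

Section product_borel.
Context (R : realType) dX dA (X : borelType dX) (A : borelType dA).
Hypotheses (countA : countable [set: A]) (discreteA : forall B : set A, open B).

Lemma measurable_discrete (B : set A) : measurable B.
Proof. by rewrite borelE; apply: sub_sigma_algebra; exact: discreteA. Qed.

Lemma measurable_open (V : set X) : open V -> measurable V.
Proof. by move=> oV; rewrite borelE; exact: sub_sigma_algebra. Qed.

Lemma measurable_closed (F : set X) : closed F -> measurable F.
Proof.
by move=> cF; rewrite -[F]setCK; apply/measurableC/measurable_open/closed_openC.
Qed.

Lemma bigcup_slice (B : set (X * A)) :
  B = \bigcup_a ([set x | B (x, a)] `*` [set a]).
Proof.
apply/seteqP; split => [[x a] Bxa|[x a] [b _ []]]; first by exists a.
by move=> /= + ->.
Qed.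

Lemma measurable_slice (B : set (X * A)) a : measurable B ->
  measurable [set x | B (x, a)].
Proof.
move=> mB; rewrite -[X in measurable X]setTI.
by apply: (@measurable_pair2 _ _ _ _ a measurableT).
Qed.

Lemma measurable_open_prod (V : set (X * A)) : open V -> measurable V.
Proof.
move=> oV; rewrite (bigcup_slice V).
apply: countable_bigcupT_measurable => // a; apply: measurableX.
  exact/measurable_open/open_slice.
exact: measurable_discrete.
Qed.

Lemma measurable_prod_open_sigma (B : set (X * A)) : measurable B ->
  <<s @open (X * A)%type >> B.
Proof.
rewrite measurable_prod_measurableType; apply: smallest_sub.
  exact: smallest_sigma_algebra.
move=> _ [B1 mB1 [B2 mB2 <-]].
pose G := [set C : set X | <<s @open (X * A)%type >> (fst @^-1` C)].
have GB1 : G B1.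
  move: B1 mB1; rewrite borelE; apply: smallest_sub.
    split.
    - by rewrite /G/= preimage_set0; exact: sigma_algebra0.
    - by move=> C GC; rewrite setTD /G/= preimage_setC -setTD;
      exact: sigma_algebraCD.
    - by move=> F GF; rewrite /G/= preimage_bigcup; exact: sigma_algebra_bigcup.
  move=> V oV; apply: sub_sigma_algebra; apply: open_comp => // z _.
  exact: cvg_fst.
rewrite (_ : _ `*` _ = (fst @^-1` B1) `&` (snd @^-1` B2)); last first.
  by apply/seteqP; split => -[x a].
apply: (@measurableI _ (g_sigma_algebraType (@open (X * A)%type))) => //.
apply: sub_sigma_algebra; apply: open_comp => // z _.
exact: cvg_snd.
Qed.

End product_borel.

Section tight_content.
Context (R : realType) dX dA (X : borelType dX) (A : borelType dA).
Hypotheses (countA : countable [set: A]) (discreteA : forall B : set A, open B).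
Hypothesis normalX : perfectly_normal R X.
Variables (m : set (X * A) -> R).
Hypothesis mP : probability_content m.

Let mo (V : set (X * A)) := measurable_open_prod countA discreteA (V := V).

Lemma probability_content_open :
  @open_content R (X * A)%type (EFin \o m).
Proof.
split => /=.
- by rewrite content0.
- by move=> V oV; rewrite lee_fin content_ge0//; exact: mo.
- by move=> V W oV oW VW; rewrite lee_fin le_content//; exact: mo.
- by move=> V W oV oW VW; rewrite -EFinD contentU//; exact: mo.
- by move=> V W oV oW; rewrite -EFinD lee_fin contentU_le//; exact: mo.
- by rewrite ltry.
Qed.

Let mu : {outer_measure set (X * A) -> \bar R} :=
  open_outer_measure probability_content_open.

Let measurable_caratheodory (B : set (X * A)) : measurable B ->
  mu.-caratheodory B.
Proof.
move=> /(measurable_prod_open_sigma discreteA) sB.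
apply: (smallest_sub _ _ sB).
  split.
  - exact: caratheodory_measurable_set0.
  - by move=> C mC; rewrite setTD; exact: caratheodory_measurable_setC.
  - exact: caratheodory_measurable_bigcup.
move=> V oV.
have [phi [cphi _ ->]] := discrete_prod_perfectly_normal discreteA normalX oV.
exact: (cozero_caratheodory probability_content_open).
Qed.

Let mu_prod (B : set (X * A)) : \bar R := mu B.

Let mu_prod0 : mu_prod set0 = 0. Proof. exact: outer_measure0. Qed.

Let mu_prod_ge0 B : 0 <= mu_prod B. Proof. exact: outer_measure_ge0. Qed.

Let mu_prod_sigma_additive : semi_sigma_additive mu_prod.
Proof.
move=> F mF tF mUF; apply: (@caratheodory_measure_sigma_additive _ _ mu) => //.
  by move=> n; exact: measurable_caratheodory.
by apply: measurable_caratheodory.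
Qed.

HB.instance Definition _ := isMeasure.Build _ _ _ mu_prod mu_prod0 mu_prod_ge0
  mu_prod_sigma_additive.

(** Prokhorov's theorem in the form used below: on open sets the limiting
    measure is at most the content, and compact sets keep their mass because
    finitely many members of an open cover suffice. *)
Lemma tight_content_probability :
  (forall e : R, (0 < e)%R -> exists K : set (X * A),
    [/\ compact K, measurable K & (1 - e <= m K)%R]) ->
  exists P : probability (X * A)%type R, forall V, open V -> P V <= (m V)%:E.
Proof.
move=> tight.
have muT : mu_prod setT = 1.
  apply/eqP; rewrite eq_le; apply/andP; split.
    rewrite -(contentT mP); apply: (open_outer_le probability_content_open).
    exact: openT.
  apply/lee_addgt0Pr => e e0; have [K [cK mK eK]] := tight e e0.
  rewrite -leeBlDr//; apply: (@le_trans _ _ (mu K)).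
    apply: (open_outer_compact probability_content_open cK) => V oV KV.
    rewrite -EFinB lee_fin; apply: le_trans eK _.
    by apply: le_content => //; exact: mo.
  by apply: le_outer_measure.
pose P0 := Measure_isProbability.Build _ _ _ mu_prod muT.
pose P : probability (X * A)%type R := HB.pack mu_prod P0.
by exists P => V oV; exact: (open_outer_le probability_content_open).
Qed.

End tight_content.

(** * Comparison of the limit measure with the setwise limit *)

Section weak_limit.
Context (R : realType) dX dA (X : borelType dX) (A : borelType dA).
Hypotheses (countA : countable [set: A]) (discreteA : forall B : set A, open B).
Hypothesis normalX : perfectly_normal R X.
Variables (m : set (X * A) -> R) (P : probability (X * A)%type R).
Hypothesis mP : probability_content m.
Hypothesis Pm : forall V, open V -> P V <= (m V)%:E.

Let mo (V : set (X * A)) := measurable_open_prod countA discreteA (V := V).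

Let mc (F : set (X * A)) : closed F -> measurable F.
Proof.
move=> cF; rewrite -[F]setCK; apply: measurableC; apply: mo.
exact: closed_openC.
Qed.

Lemma content_le_closed (F : set (X * A)) : closed F -> (m F)%:E <= P F.
Proof.
move=> cF; have := Pm (closed_openC cF).
rewrite (probability_setC P (mc cF)) (contentC mP (mc cF)).
rewrite (probability_fine P (mc cF)).
by rewrite -EFinB !lee_fin lerD2l lerN2.
Qed.

Section dominated.
Variables (E : set (X * A)) (nu : {measure set (X * A) -> \bar R}).
Hypotheses (oE : open E) (nu_fin : nu setT < +oo).
Hypothesis dom : forall B, measurable B -> (m (B `&` E))%:E <= nu B.

Let mE : measurable E := mo oE.

Let nu_fin_num B : measurable B -> nu B \is a fin_num.
Proof.
move=> mB; rewrite ge0_fin_numE//; apply: le_lt_trans nu_fin.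
by apply: le_measure; rewrite ?inE.
Qed.

Let trace (B : set (X * A)) : \bar R := `|m (B `&` E)|%:E.

Let traceE B : measurable B -> trace B = (m (B `&` E))%:E.
Proof.
by move=> mB; rewrite /trace ger0_norm// content_ge0//; exact: measurableI.
Qed.

Let trace0 : trace set0 = 0.
Proof. by rewrite traceE// set0I content0. Qed.

Let trace_ge0 B : 0 <= trace B.
Proof. by rewrite lee_fin. Qed.

(** A finitely additive set function below a finite measure is continuous at
    the empty set. *)
Let trace_sigma_additive : semi_sigma_additive trace.
Proof.
move=> F mF tF mUF; rewrite traceE//.
pose S n := \big[setU/set0]_(i < n) F i.
have mS n : measurable (S n) by exact: bigsetU_measurable.
have SE n : \sum_(0 <= i < n) trace (F i) = (m (S n `&` E))%:E.
  elim: n => [|n ih]; first by rewrite big_geq// /S big_ord0 set0I content0.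
  rewrite big_nat_recr//= ih traceE// -EFinD -contentU//;
    [|exact: measurableI..|].
    by congr (m _)%:E; rewrite /S big_ord_recr/= setIUl.
  apply/seteqP; split => // x [[+ _] [Fnx _]].
  rewrite /S -bigcup_mkord => -[i /= ni Fix].
  by move: ni; rewrite (tF i n) ?ltnn//; exists x.
rewrite (_ : (fun n => _) = EFin \o (fun n => m (S n `&` E))); last first.
  by apply/funext => n; exact: SE.
apply: cvg_EFin; first by near=> n.
have nuS : fine (nu (S n)) @[n --> \oo] --> fine (nu (\bigcup_n F n)).
  apply: fine_cvg; rewrite fineK ?nu_fin_num//.
  rewrite (_ : \bigcup_n F n = \bigcup_n S n); last first.
    apply/seteqP; split => x [k _ Fx].
      by exists k.+1 => //; rewrite /S -bigcup_mkord; exists k => /=.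
    by move: Fx; rewrite /S -bigcup_mkord => -[i _ ?]; exists i.
  apply: nondecreasing_cvg_mu => //; first by exact: bigcupT_measurable.
  move=> n k nk; apply/subsetPset; rewrite /S -!bigcup_mkord.
  by apply: bigcup_subset => i /= /leq_trans; exact.
set M := m (\bigcup_n F n `&` E); set N := fine (nu (\bigcup_n F n)) in nuS *.
apply: (@squeeze_cvgr _ _ _ _ (fun n => M - (N - fine (nu (S n))))%R (cst M)).
- near=> n; have Sn : S n `<=` \bigcup_n F n.
    by rewrite /S -bigcup_mkord; exact: bigcup_subset.
  apply/andP; split; last by apply: le_content => //;
    [exact: measurableI..|exact: setSI].
  have -> : M = (m (S n `&` E) + m ((\bigcup_n F n `\` S n) `&` E))%R.
    rewrite /M (contentID mP _ (mS n)); last exact: measurableI.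
    by congr (m _ + m _)%R; apply/seteqP; split => x /=; move: (Sn x); tauto.
  have -> : N = (fine (nu (S n)) + fine (nu (\bigcup_n F n `\` S n)))%R.
    rewrite /N -fineD ?nu_fin_num//; last exact: measurableD.
    rewrite -measureU ?setDUK//; first exact: measurableD.
    by rewrite setDE setICA setICr setI0.
  rewrite [X in (_ - X)%R]addrAC subrr add0r -addrA gerDl subr_le0.
  have mD : measurable (\bigcup_n F n `\` S n) by exact: measurableD.
  by rewrite -lee_fin fineK ?nu_fin_num// dom.
- rewrite -[X in _ --> X]subr0 -[X in (_ - X)%R](subrr N).
  by apply: cvgB; [exact: cvg_cst|apply: cvgB => //; exact: cvg_cst].
- exact: cvg_cst.
Unshelve. all: by end_near. Qed.

HB.instance Definition _ := isMeasure.Build _ _ _ trace trace0 trace_ge0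
  trace_sigma_additive.

Let mrestr_trace_open (V : set (X * A)) : open V -> mrestr P mE V = trace V.
Proof.
move=> oV; have oVE := openI oV oE; rewrite /mrestr.
apply/eqP; rewrite eq_le; apply/andP; split.
  by rewrite traceE; [exact: Pm|exact: mo].
have [phi [cphi _ VE]] := discrete_prod_perfectly_normal discreteA normalX oVE.
pose F n := [set z | (n.+1%:R^-1 <= phi z)%R].
have cF n : closed (F n).
  rewrite (_ : F n = phi @^-1` [set y | (n.+1%:R^-1 <= y)%R]) //.
  by apply: closed_comp => [z _|]; [exact: cphi|exact: closed_ge].
have UF : \bigcup_n F n = V `&` E.
  rewrite VE; apply/seteqP; split => [z [n _]|z /= z0].
    by apply: lt_le_trans; rewrite invr_gt0.
  have [n nz] := ltr_add_invr z0; exists n => //.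
  by move: nz; rewrite add0r => /ltW.
have FVE n : F n `<=` V `&` E by rewrite -UF; exact: bigcup_sup.
have : trace (F n) @[n --> \oo] --> trace (V `&` E).
  rewrite -UF; apply: nondecreasing_cvg_mu.
  - by move=> n; exact: mc.
  - by apply: bigcupT_measurable => n; exact: mc.
  - move=> n k nk; apply/subsetPset => z; apply: le_trans.
    by rewrite lef_pV2 ?posrE// ler_nat ltnS.
have -> : trace (V `&` E) = trace V by rewrite /trace -setIA setIid.
move=> /(cvge_le _); apply; apply: nearW => n.
rewrite traceE; last exact: mc.
rewrite setIidl; last by move=> z /FVE[].
apply: le_trans (content_le_closed (cF n)) _.
by apply: le_measure; rewrite ?inE; [exact: mc|exact: mo|].
Qed.

(** On a set where it is dominated by a measure, the content is itself a
    measure, and it is determined there by its comparison with [P] on open and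
    on closed sets. *)
Lemma dominated_limit_eq B : measurable B -> P (B `&` E) = (m (B `&` E))%:E.
Proof.
move=> mB; rewrite -traceE//.
apply: (@g_sigma_algebra_measure_unique _ _ _ (@open (X * A)%type)
  (fun V oV => mo oV) (fun=> setT) _ _ (mrestr P mE) trace) => //.
- by move=> _; exact: openT.
- by apply/seteqP; split => // z _; exists 0%N.
- exact: openI.
- by move=> _; rewrite -[ltLHS]/(P (setT `&` E)) setTI
  (probability_fine P mE) ltry.
- exact: measurable_prod_open_sigma.
Qed.

(** Over [D] the set [G] coincides with the open set [W], for which [P] is at
    most the content; off [D] and inside [O] the two set functions are equal,
    so the part of [W `&` O] there can be exchanged for that of [G `&` O]. *)
Lemma limit_le_relatively_open (O D G W : set (X * A)) :
  open O -> closed D -> E = O `\` D -> measurable G -> open W ->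
  G `&` D = W `&` D -> P (G `&` O) <= (m G)%:E.
Proof.
move=> oO cD EOD mG oW GW; have mD := mc cD; have mO := mo oO.
have mW := mo oW; have oWO := openI oW oO; have mWO := mo oWO.
have split_P C : measurable C -> P C = P (C `&` D) + P (C `\` D).
  move=> mC; rewrite -measureU ?setUIDK//;
    [exact: measurableI|exact: measurableD|].
  by rewrite setDE setIACA setICr setI0.
have eqE C : measurable C -> P ((C `&` O) `\` D) = (m ((C `&` O) `\` D))%:E.
  by move=> mC; have := dominated_limit_eq mC; rewrite EOD setDE setIA -setDE.
have WD : (W `&` O) `&` D = (G `&` O) `&` D by rewrite setIAC -GW setIAC.
have mGO : measurable (G `&` O) by exact: measurableI.
have {}WP : P ((G `&` O) `&` D) <= (m ((G `&` O) `&` D))%:E.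
  have := Pm oWO; rewrite (split_P _ mWO) (contentID mP mWO mD) EFinD -eqE// WD.
  by rewrite leeD2rE// fin_num_measure//; exact: measurableD.
apply: (@le_trans _ _ (m (G `&` O))%:E); last first.
  by rewrite lee_fin le_content//; exact: subIsetl.
rewrite (split_P _ mGO) (contentID mP mGO mD) EFinD -eqE//.
by rewrite leeD2r.
Qed.

End dominated.
End weak_limit.

(** * Integrals and superlevel sets *)

Section level_sets.
Context (R : realType).
Implicit Types (y : \bar R) (h : R) (n : nat).

Definition level_count h n y : nat :=
  (\sum_(k < n) nat_of_bool ((k.+1%:R * h)%:E < y)%E)%N.

Lemma level_count_le h n y : (level_count h n y <= n)%N.
Proof.
rewrite /level_count -[leqRHS]muln1 -[X in
  (_ <= X * 1)%N]card_ord -sum_nat_const.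
by apply: leq_sum => i _; exact: leq_b1.
Qed.

Lemma level_count_lower h n y : (0 <= h)%R -> 0 <= y ->
  ((level_count h n y)%:R * h)%:E <= y.
Proof.
move=> h0 y0; elim: n => [|n ih]; first by rewrite /level_count big_ord0 mul0r.
rewrite /level_count big_ord_recr/= -/(level_count h n y).
have [lt|_] := boolP ((n.+1%:R * h)%:E < y); last by rewrite addn0.
apply: le_trans (ltW lt); rewrite lee_fin ler_wpM2r// ler_nat addn1 ltnS.
exact: level_count_le.
Qed.

Lemma level_count_upper h n y : (0 <= h)%R ->
  y <= ((level_count h n y).+1%:R * h)%:E \/ level_count h n y = n.
Proof.
move=> h0; elim: n => [|n ih]; first by right; rewrite /level_count big_ord0.
rewrite /level_count big_ord_recr/= -/(level_count h n y).
case: ih => [yN|->].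
  left; apply: le_trans yN _; rewrite lee_fin ler_wpM2r// ler_nat ltnS.
  exact: leq_addr.
by have [lt|] := ltP (n.+1%:R * h)%:E y; [right; rewrite addn1|left;
  rewrite addn0].
Qed.

Context d (T : measurableType d).
Implicit Types f : T -> \bar R.

Definition above f (t : R) : set T := [set x | t%:E < f x].

Lemma measurable_above f t : measurable_fun setT f -> measurable (above f t).
Proof.
by move=> mf; rewrite -[above f t]setTI; exact: emeasurable_fun_o_infty.
Qed.

Let level_countE f h n x : ((level_count h n (f x))%:R * h)%:E =
  \sum_(k < n) (h%:E * (\1_(above f (k.+1%:R * h)) x)%:E).
Proof.
rewrite /level_count natr_sum mulr_suml -sumEFin; apply: eq_bigr => k _.
by rewrite -EFinM mulrC indicE mem_setE.
Qed.

Let measurable_level f h t : measurable_fun setT f ->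
  measurable_fun setT (fun x => h%:E * (\1_(above f t) x)%:E).
Proof.
move=> mf; apply: measurable_funeM; apply/measurable_EFinP.
exact/measurable_indic/measurable_above.
Qed.

Lemma measurable_level_count f h n : measurable_fun setT f ->
  measurable_fun setT (fun x => ((level_count h n (f x))%:R * h)%:E).
Proof.
move=> mf; under eq_fun do rewrite level_countE.
by apply: emeasurable_sum => k; exact: measurable_level.
Qed.

Lemma integral_level_count (mu : {measure set T -> \bar R}) f h n :
  measurable_fun setT f -> (0 <= h)%R ->
  \int[mu]_x ((level_count h n (f x))%:R * h)%:E =
  \sum_(k < n) h%:E * mu (above f (k.+1%:R * h)).
Proof.
move=> mf h0.
under eq_integral do rewrite level_countE.
rewrite ge0_integral_sum//; last 2 first.
- by move=> k; exact: measurable_level.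
- by move=> k x _; rewrite mule_ge0// lee_fin.
apply: eq_bigr => k _; rewrite ge0_integralZl//; last first.
  by apply/measurable_EFinP/measurable_indic/measurable_above.
by rewrite integral_indic ?setIT//; exact: measurable_above.
Qed.

Lemma levels_le_integral (mu : {measure set T -> \bar R}) f h n :
  measurable_fun setT f -> (forall x, 0 <= f x) -> (0 <= h)%R ->
  \sum_(k < n) h%:E * mu (above f (k.+1%:R * h)) <= \int[mu]_x f x.
Proof.
move=> mf f0 h0; rewrite -integral_level_count//.
apply: ge0_le_integral => //.
- by move=> x _; rewrite lee_fin mulr_ge0.
- exact: measurable_level_count.
- by move=> x _; exact: level_count_lower.
Qed.

Let truncation_cvg (y : \bar R) : 0 <= y ->
  mine y n%:R%:E @[n --> \oo] --> y.
Proof.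
case: y => [r| |]// r0; last first.
  rewrite (_ : (fun n => _) = EFin \o (fun n => n%:R)); last first.
    by apply/funext => n /=; rewrite min_r// leey.
  by apply/cvgenyP.
apply: cvg_near_cst; near=> n; rewrite min_l// lee_fin.
by near: n; exact: nbhs_infty_ger.
Unshelve. all: by end_near. Qed.

(** The truncation [mine f n] exceeds the staircase with steps of height [h]
    and enough levels by at most [h]. *)
Lemma integral_le_levels (P : probability T R) f C :
  measurable_fun setT f -> (forall x, 0 <= f x) ->
  (forall h n, (0 < h)%R ->
    \sum_(k < n) h%:E * P (above f (k.+1%:R * h)) <= C) ->
  \int[P]_x f x <= C.
Proof.
move=> mf f0 fC.
have mg n : measurable_fun setT (fun x => mine (f x) n%:R%:E).
  by apply: measurable_mine => //; exact: measurable_cst.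
have g0 n x : 0 <= mine (f x) n%:R%:E.
  by rewrite le_min f0 lee_fin ler0n.
have -> : \int[P]_x f x = \int[P]_x limn (fun n => mine (f x) n%:R%:E).
  by apply: eq_integral => x _; apply/esym/cvg_lim => //; exact: truncation_cvg.
have := @cvg_monotone_convergence _ _ _ P _ measurableT _ mg
  (fun n x _ => g0 n x).
move=> /(_ _)/(cvge_le _); apply; last first.
  move=> x _ n k nk; rewrite le_min ge_min lexx/= ge_min lee_fin ler_nat nk.
  by rewrite orbT.
apply: nearW => n; apply/lee_addgt0Pr => h h0.
pose K := (Num.truncn (n%:R / h)).+1.
have KhE : (n%:R <= K%:R * h)%R.
  rewrite -ler_pdivrMr//; apply/ltW.
  by have /andP[] := truncn_itv (divr_ge0 (ler0n R n) (ltW h0)).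
apply: (@le_trans _ _ (\int[P]_x (((level_count h K (f x))%:R * h)%:E + h%:E))).
  apply: ge0_le_integral => //.
  - by apply: emeasurable_funD;
    [exact: measurable_level_count|exact: measurable_cst].
  - move=> x _; rewrite -EFinD ge_min -[X in (_ + X)%R]mul1r -mulrDl natr1.
    have [le|eqK] := level_count_upper K (f x) (ltW h0).
      by rewrite le.
    rewrite eqK lee_fin (le_trans KhE) ?orbT// ler_wpM2r ?ler_nat//.
    exact: ltW.
rewrite ge0_integralD//; last 3 first.
- by move=> x _; rewrite lee_fin mulr_ge0// ltW.
- exact: measurable_level_count.
- by move=> x _; rewrite lee_fin ltW.
rewrite integral_cst// -[X in _ * X]/(P setT) probability_setT mule1 leeD2r//.
by rewrite integral_level_count//; [exact: fC|exact: ltW].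
Qed.

End level_sets.

(** * Integrals in the limit; compact sets of state-action pairs *)

Section limit_integral.
Context d (T : measurableType d) (R : realType).
Variables (U : set_system nat) (g : nat -> probability T R) (m : set T -> R).
Hypotheses (UP : ProperFilter U) (gm : setwise_limit U g m).

Let levels_cvg (E : nat -> set T) (h : R) n : (forall k, measurable (E k)) ->
  (\sum_(k < n) h * fine (g i (E k)))%R @[i --> U] -->
  (\sum_(k < n) h * m (E k))%R.
Proof.
move=> mE; elim: n => [|n ih].
  under eq_fun do rewrite big_ord0.
  by rewrite big_ord0; exact: cvg_cst.
under eq_fun do rewrite big_ord_recr/=.
rewrite big_ord_recr/=; apply: cvgD => //.
by apply: cvgM; [exact: cvg_cst|exact: gm].
Qed.

(** Fatou's inequality fails for limits along an ultrafilter, but the integral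
    of [f] is a limit of finite combinations of the numbers [P (above f t)], to
    which setwise convergence applies. *)
Lemma limit_integral_le (P : probability T R) (f : T -> \bar R) C :
  measurable_fun setT f -> (forall x, 0 <= f x) ->
  (forall t, P (above f t) <= (m (above f t))%:E) ->
  (\forall n \near U, \int[g n]_x f x <= C) ->
  \int[P]_x f x <= C.
Proof.
move=> mf f0 Pm fC; case: C fC => [r| |] fC; [|exact: leey|]; last first.
  have [n] := filter_ex fC; rewrite leeNy_eq => /eqP gn.
  by have := @integral_ge0 _ _ _ (g n) setT f (fun x _ => f0 x); rewrite gn.
apply: integral_le_levels => // h n h0.
have mE k : measurable (above f (k.+1%:R * h)) by exact: measurable_above.
apply: (@le_trans _ _ (\sum_(k < n) h * m (above f (k.+1%:R * h)))%:E).
  rewrite -sumEFin; apply: lee_sum => k _; rewrite EFinM.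
  by apply: lee_wpmul2l => //; rewrite lee_fin ltW.
rewrite lee_fin.
have := @levels_cvg (fun k => above f (k.+1%:R * h)) h n mE.
move=> /(ler_cvg_to)/(_ (cvg_cst r)); apply.
apply: filterS fC => i ir; rewrite -lee_fin; apply: le_trans ir.
apply: le_trans (levels_le_integral (g i) n mf f0 (ltW h0)).
rewrite -sumEFin; apply: lee_sum => k _.
by rewrite EFinM -probability_fine.
Qed.

End limit_integral.

Section product_compact.
Context (R : realType) dX dA (X : borelType dX) (A : borelType dA).
Hypothesis discreteA : forall B : set A, open B.

Lemma discrete_prod_hausdorff : metrizable R X ->
  hausdorff_space (X * A)%type.
Proof.
move=> [N [f [g [_ fK cf _]]]]; rewrite open_hausdorff => -[x a] [y b] xayb.
have [ab|/eqP ab] := eqVneq a b; last first.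
  exists (snd @^-1` [set a], snd @^-1` [set b]); first by rewrite !inE.
  split; [by apply: open_comp => // z _; exact: cvg_snd..|].
  by apply/eqP/seteqP; split => // -[z c]/= [->].
have : f x != f y.
  by apply: contra_neq xayb => /(can_inj fK) ->; rewrite ab.
have := @metric_hausdorff R N; rewrite open_hausdorff => hN /hN.
move=> [[V W]/= [xV yW] [oV oW /eqP VW]].
exists ((f \o fst) @^-1` V, (f \o fst) @^-1` W);
  first by rewrite !inE in xV yW *.
have cff : continuous (f \o fst : X * A -> N).
  by move=> z; apply: continuous_comp; [exact: cvg_fst|exact: cf].
split; [by apply: open_comp => // z _; exact: cff..|].
apply/eqP/seteqP; split => // z [Vz Wz].
by have : (V `&` W) (f z.1) by []; rewrite VW.
Qed.

Lemma compact_finite_actions (K : set (X * A)) : compact K ->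
  exists s : seq A, snd @` K `<=` [set` s].
Proof.
move=> cK.
have : compact (snd @` K).
  apply: continuous_compact => //; apply: continuous_subspaceT => z.
  exact: cvg_snd.
rewrite compact_cover => /(_ A setT (fun a => [set a]))[].
- by move=> a _; exact: discreteA.
- by move=> a _; exists a.
by move=> D _ KD; exists (finmap.enum_fset D) => a /KD[b /= bD ->]; exact: bD.
Qed.

End product_compact.

(** * Nearly invariant sequences of measures *)

Section slice_measure.
Context (R : realType) dX dA (X : measurableType dX) (A : measurableType dA).
Variables (nu : {measure set X -> \bar R}) (a : A).

Definition slice_measure (B : set (X * A)) : \bar R := nu [set x | B (x, a)].

Let slice_measure0 : slice_measure set0 = 0.
Proof. by rewrite /slice_measure measure0. Qed.

Let slice_measure_ge0 B : 0 <= slice_measure B.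
Proof. exact: measure_ge0. Qed.

Let slice_measure_sigma_additive : semi_sigma_additive slice_measure.
Proof.
have mslice (B : set (X * A)) : measurable B -> measurable [set x | B (x, a)].
  move=> mB; rewrite -[X in measurable X]setTI.
  exact: (@measurable_pair2 _ _ _ _ a measurableT).
move=> F mF tF mUF; rewrite /slice_measure.
rewrite (_ : [set x | _] = \bigcup_n [set x | F n (x, a)]) //.
apply: measure_semi_sigma_additive.
- by move=> n; exact: mslice.
- by move=> i j _ _ [x [Fi Fj]]; apply: tF => //; exists (x, a).
- exact: (mslice _ mUF).
Qed.

HB.instance Definition _ := isMeasure.Build _ _ _ slice_measure
  slice_measure0 slice_measure_ge0 slice_measure_sigma_additive.

End slice_measure.

Section near_invariant_sequences.
Context (R : realType) dX dA (X : borelType dX) (A : borelType dA) (d : nat).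
Variable M : cmdp R X A d.
Variable Gam : nat -> set (X * A).

(** Continuity of the transition kernel over [D] enters as this property of the
    functions [next_integral v] with [v] continuous. *)
Definition majorized_lsc (f : X * A -> \bar R) : Prop := forall j,
  exists (O D : set X) (nu : {finite_measure set X -> \bar R}),
    [/\ open O, fst @` Gam j `<=` O, closed D,
        forall B z, measurable B -> admissible_graph M z ->
          transition M z ((O `\` D) `&` B) <= nu B &
        lower_semicontinuous (f : subspace (D `*` [set: A]) -> \bar R)].

Definition next_integral (v : X -> \bar R) (z : X * A) : \bar R :=
  \int[transition M z]_y v y.

Lemma measurable_next_integral v : measurable_fun setT v ->
  (forall x, 0 <= v x) -> measurable_fun setT (next_integral v).
Proof.
move=> mv v0; apply: measurable_fun_integral_kernel => // B mB.
exact: measurable_kernel.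
Qed.

(** The instances are the averages over the first [n.+1] stages, with
    [e = n.+1%:R^-1], and the laws of stationary pairs, with [e = 0]. *)
Definition near_invariant (gamma : probability (X * A)%type R) (e : R) : Prop :=
  forall v : X -> \bar R, measurable_fun setT v -> (forall x, 0 <= v x <= 1) ->
    \int[gamma]_z next_integral v z <= \int[gamma]_z v z.1 + e%:E /\
    \int[gamma]_z v z.1 <= \int[gamma]_z next_integral v z + e%:E.

Variables (U : set_system nat) (g : nat -> probability (X * A)%type R).
Variables (delta : nat -> R) (m : set (X * A) -> R).
Variable P : probability (X * A)%type R.
Hypotheses (UP : ProperFilter U) (delta0 : delta n @[n --> U] --> 0%R).
Hypothesis g_near : forall n, near_invariant (g n) (delta n).
Hypothesis g_graph : forall n, g n (admissible_graph M) = 1.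
Hypothesis gm : setwise_limit U g m.
Hypothesis Pm : forall V, open V -> P V <= (m V)%:E.
Hypothesis normalX : perfectly_normal R X.
Hypothesis closed_Gam : forall j, closed (Gam j).
Hypothesis compact_Gam : forall j, compact (Gam j).
Hypothesis tight : forall e : R, (0 < e)%R -> exists j, (1 - e <= m (Gam j))%R.

Let mP : probability_content m := setwise_limit_content UP gm.
Let countA := action_countable M.
Let discreteA := action_discrete M.
Let mgraph : measurable (admissible_graph M) := measurable_admissible_graph M.

Lemma integral_graph_le (gamma : probability (X * A)%type R)
    (f : X * A -> \bar R) (c : \bar R) :
  gamma (admissible_graph M) = 1 -> measurable_fun setT f ->
  (forall z, 0 <= f z) -> 0 <= c ->
  (forall z, admissible_graph M z -> f z <= c) ->
  \int[gamma]_z f z <= c.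
Proof.
move=> g1 mf f0 c0 fc; apply: (@le_trans _ _ (\int[gamma]_z cst c z)).
  apply: ae_ge0_le_integral => //.
  exists (~` admissible_graph M); split; first exact: measurableC.
    have := probability_setC gamma mgraph.
    by rewrite g1 subee.
  by move=> z /= /not_implyP[_ fz] gz; apply: fz; exact: fc.
by rewrite integral_cst// -[X in _ * X]/(gamma setT) probability_setT mule1.
Qed.

(** The bound holds for the law of the next state, and near invariance turns it
    into a bound for the law of the current one. *)
Lemma content_majorized (C : set X) (c : \bar R) : measurable C -> 0 <= c ->
  (forall z, admissible_graph M z -> transition M z C <= c) ->
  (m (fst @^-1` C))%:E <= c.
Proof.
move=> mC c0 qc; case: c c0 qc => [c| |] c0 qc; [|exact: leey|by []].
have mfC : measurable (fst @^-1` C : set (X * A)).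
  by rewrite -[X in measurable X]setTI; exact: measurable_fst.
rewrite lee_fin -[leRHS]addr0.
apply: (ler_cvg_to (gm mfC) (cvgD (cvg_cst c) delta0)).
apply: nearW => n /=; rewrite -lee_fin -probability_fine// EFinD.
have mv : measurable_fun setT (EFin \o \1_C : X -> \bar R).
  exact/measurable_EFinP/measurable_indic.
have v01 x : 0 <= (EFin \o \1_C : X -> \bar R) x <= 1.
  by rewrite /= !lee_fin indicE; case: (_ \in _); rewrite /= ?lexx ler01.
have [_] := g_near n mv v01.
rewrite [X in X <= _ -> _](_ : _ = g n (fst @^-1` C)); last first.
  by have := integral_indic (g n) measurableT mfC; rewrite setIT => <-.
move=> /le_trans; apply; rewrite leeD2r//.
apply: integral_graph_le => //.
- by apply: measurable_next_integral => // x; case/andP: (v01 x).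
- by move=> z; apply: integral_ge0 => y _; case/andP: (v01 y).
- move=> z gz; rewrite /next_integral integral_indic// setIT; exact: qc.
Qed.

(** Only finitely many actions matter on a compact set, so the bound on the
    transition kernel gives a finite measure on the product. *)
Lemma content_majorized_prod (E : set X) (nu : {measure set X -> \bar R})
    (s : seq A) : measurable E -> nu setT < +oo ->
  (forall B z, measurable B -> admissible_graph M z ->
    transition M z (E `&` B) <= nu B) ->
  exists2 nus : {measure set (X * A) -> \bar R}, nus setT < +oo &
    forall B, measurable B -> (m (B `&` (E `*` [set` s])))%:E <= nus B.
Proof.
move=> mE nuoo dom; elim: s => [|a s [nus nusoo ih]].
  exists mzero => [|B mB]; first by rewrite /mzero ltry.
  rewrite (_ : _ `&` _ = set0) ?content0//.
  by apply/seteqP; split => // z [_ []].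
pose nusa : {measure set (X * A) -> \bar R} :=
  measure_add nus (slice_measure nu a).
have addE B : nusa B = nus B + nu [set x | B (x, a)] by exact: measure_addE.
exists nusa.
  by rewrite addE lte_add_pinfty.
move=> B mB; rewrite addE.
pose Ba := [set x | B (x, a)].
have mBa : measurable Ba by exact: measurable_slice.
have mEs : measurable (B `&` (E `*` [set` s])).
  by apply: measurableI => //; apply: measurableX => //;
    exact: measurable_discrete.
have mEa : measurable (fst @^-1` (E `&` Ba) : set (X * A)).
  rewrite -[X in measurable X]setTI; apply: measurable_fst => //.
  exact: measurableI.
apply: (@le_trans _ _ (m ((B `&` (E `*` [set` s])) `|` fst @^-1`
  (E `&` Ba)))%:E).
  rewrite lee_fin le_content//; [|exact: measurableU|].
    apply: measurableI => //; apply: measurableX => //.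
    exact: measurable_discrete.
  move=> [x b] [Bxb [/= Ex]]; rewrite inE => /orP[/eqP bE|bs]; last by left.
  by right; split => //; rewrite /Ba/= -bE.
apply: (@le_trans _ _ (m (B `&` (E `*` [set` s])) + m (fst @^-1`
  (E `&` Ba)))%:E).
  by rewrite lee_fin contentU_le.
rewrite EFinD leeD ?ih//; apply: content_majorized => //.
  exact: measurableI.
by move=> z gz; exact: dom.
Qed.

Lemma limit_tight e : (0 < e)%R -> exists j, 1 - e%:E <= P (Gam j).
Proof.
move=> /tight[j je]; exists j.
apply: le_trans (content_le_closed countA discreteA mP Pm (@closed_Gam j)).
by rewrite -EFinB lee_fin.
Qed.

(** Up to a small mass everything happens in some [Gam j], where only finitely
    many actions occur and [limit_le_relatively_open] applies. *)
Lemma limit_above_le f t : measurable_fun setT f -> majorized_lsc f ->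
  P (above f t) <= (m (above f t))%:E.
Proof.
move=> mf lf; have mG := measurable_above t mf; set G := above f t in mG *.
have mGam j : measurable (Gam j).
  rewrite -[Gam j]setCK; apply: measurableC.
  by apply: measurable_open_prod => //; exact: closed_openC.
have PGj j : P (G `&` Gam j) <= (m G)%:E.
  have [V [D [nu [oV GamV cD dom lscf]]]] := lf j.
  have [s Gs] := compact_finite_actions discreteA (@compact_Gam j).
  have nuoo : nu setT < +oo by rewrite ltey_eq fin_num_measure.
  have mOD : measurable (V `\` D).
    by apply: measurableD; [exact: measurable_open|exact: measurable_closed].
  have [nus nusoo doms] := content_majorized_prod s mOD nuoo dom.
  have [W oW WG] : exists2 W, open W &
      W `&` (D `*` [set: A]) = G `&` (D `*` [set: A]).
    by apply/open_subspaceP; move/lower_semicontinuousP : lscf; apply.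
  have oE : open ((V `\` D) `*` [set` s] : set (X * A)).
    rewrite (_ : _ `*` _ = fst @^-1` (V `\` D) `&` snd @^-1` [set` s])//.
    apply: openI; last by apply: open_comp => // z _; exact: cvg_snd.
    apply: open_comp => [z _|]; first exact: cvg_fst.
    by apply: openI => //; exact: closed_openC.
  apply: (@le_trans _ _ (P (G `&` (V `*` [set` s])))).
    apply: le_measure; rewrite ?inE.
    - exact: measurableI.
    - apply: measurableI => //; apply: measurableX;
      first exact: measurable_open.
      exact: measurable_discrete.
    - move=> z [Gz jz]; split => //; split; first by apply: GamV; exists z.
      by apply: Gs; exists z.
  apply: (limit_le_relatively_open countA discreteA normalX mP Pm oE nusoo doms
    _ _ _ mG oW (esym WG)).
  - rewrite (_ : _ `*` _ = fst @^-1` V `&` snd @^-1` [set` s])//.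
    by apply: openI; apply: open_comp => // z _;
      [exact: cvg_fst|exact: cvg_snd].
  - rewrite (_ : _ `*` _ = fst @^-1` D); last by apply/seteqP;
    split => -[x a] //= [].
    by apply: closed_comp => // z _; exact: cvg_fst.
  - by apply/seteqP; split => -[x a]/=; rewrite /setX/=; tauto.
apply/lee_addgt0Pr => e /limit_tight[j je].
apply: (@le_trans _ _ (P (G `&` Gam j) + P (~` Gam j))).
  apply: le_trans (measureU2 _ _ _); [|exact: measurableI|exact: measurableC].
  apply: le_measure; rewrite ?inE//.
    by apply: measurableU; [exact: measurableI|exact: measurableC].
  by move=> z Gz; have [?|?] := pselect (Gam j z); [left|right].
apply: leeD; first exact: PGj.
rewrite probability_setC// leeBlDr ?fin_num_measure// addeC -leeBlDr//.
Qed.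

Lemma near_limit_integral_le f C : measurable_fun setT f ->
  (forall z, 0 <= f z) -> majorized_lsc f ->
  (\forall n \near U, \int[g n]_z f z <= C) -> \int[P]_z f z <= C.
Proof.
move=> mf f0 lf; apply: (limit_integral_le UP gm) => // t.
exact: limit_above_le.
Qed.

End near_invariant_sequences.

(** * Integration against a semidirect product *)

Section integral_semidirect.
Context d1 d2 (T1 : measurableType d1) (T2 : measurableType d2) (R : realType).
Variables (P : probability T1 R) (k : R.-pker T1 ~> T2).

Let measurable_integral (f : T1 * T2 -> \bar R) : measurable_fun setT f ->
  (forall z, 0 <= f z) -> measurable_fun setT (fun t => \int[k t]_u f (t, u)).
Proof.
by move=> mf f0; apply: measurable_fun_integral_finite_kernel.
Qed.

Import HBNNSimple.

Let integral_semidirect_nnsfun (f : {nnsfun (T1 * T2)%type >-> R}) :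
  \int[semidirect P k]_z (f z)%:E = \int[P]_t \int[k t]_u (f (t, u))%:E.
Proof.
have fE z : (f z)%:E =
    \sum_(r \in range f) (r%:E * (\1_(f @^-1` [set r]) z)%:E).
  by rewrite fimfunE -fsumEFin.
have mf r : measurable (f @^-1` [set r]) by [].
have m1 r : measurable_fun setT
    (fun z => r%:E * (\1_(f @^-1` [set r]) z)%:E : \bar R).
  by apply: measurable_funeM; exact/measurable_EFinP/measurable_indic.
have p1 r z : 0 <= r%:E *
  (\1_(f @^-1` [set r]) z)%:E by exact: nnfun_muleindic_ge0.
have r_ge0 r : range f r -> (0 <= r)%R by move=> [z _ <-].
have msec r t : measurable (xsection (f @^-1` [set r]) t).
  exact: measurable_xsection.
have secE r t u : \1_(f @^-1` [set r]) (t, u) =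
    \1_(xsection (f @^-1` [set r]) t) u :> R.
  by rewrite !indicE mem_xsection.
have kE t : \int[k t]_u (f (t, u))%:E =
    \sum_(r \in range f) (r%:E * k t (xsection (f @^-1` [set r]) t)).
  under eq_integral do rewrite fE.
  rewrite ge0_integral_fsum//; last first.
    by move=> r; apply: measurableT_comp (m1 r) (measurable_pair1 t).
  apply: eq_fsbigr => r; rewrite inE => /r_ge0 r0.
  under eq_integral do rewrite secE.
  rewrite ge0_integralZl//; last exact/measurable_EFinP/measurable_indic.
  by rewrite integral_indic// setIT.
under [RHS]eq_integral do rewrite kE.
have mk r : measurable_fun setT (fun t => k t (xsection (f @^-1` [set r]) t)).
  by apply: measurable_fun_xsection_finite_kernel; rewrite inE.
rewrite ge0_integral_fsum//; last 2 first.
- by move=> r; exact: measurable_funeM.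
- move=> r t _; have [r0|r0] := leP 0%R r; first by rewrite mule_ge0.
  rewrite [X in k t X](_ : _ = set0) ?measure0 ?mule0//.
  apply/seteqP; split => // u; rewrite /xsection/= inE/= => fr.
  by move: r0; rewrite -fr ltNge fun_ge0.
under eq_integral do rewrite fE.
rewrite ge0_integral_fsum//; apply: eq_fsbigr => r; rewrite inE => /r_ge0 r0.
rewrite !ge0_integralZl//; last by apply/measurable_EFinP/measurable_indic.
by rewrite integral_indic// setIT.
Qed.

Lemma integral_semidirect (f : T1 * T2 -> \bar R) :
  measurable_fun setT f -> (forall z, 0 <= f z) ->
  \int[semidirect P k]_z f z = \int[P]_t \int[k t]_u f (t, u).
Proof.
move=> mf f0; pose f_ := nnsfun_approx measurableT mf.
have cvg_f z : (f_ n z)%:E @[n --> \oo] --> f z by exact: cvg_nnsfun_approx.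
have nd_f z n m : (n <= m)%N -> (f_ n z)%:E <= (f_ m z)%:E.
  by move=> nm; rewrite lee_fin; exact/lefP/nd_nnsfun_approx.
have mf_ n : measurable_fun setT (EFin \o f_ n) by exact/measurable_EFinP.
transitivity (limn (fun n => \int[semidirect P k]_z (f_ n z)%:E)).
  rewrite -monotone_convergence//; [|by move=> n z _; rewrite lee_fin|].
    by apply: eq_integral => z _; apply/esym/cvg_lim.
  by move=> z _ n m; exact: nd_f.
have mfk n t : measurable_fun setT (fun u => (f_ n (t, u))%:E).
  exact: measurableT_comp (mf_ n) (measurable_pair1 t).
transitivity (limn (fun n => \int[P]_t \int[k t]_u (f_ n (t, u))%:E)).
  by congr (limn _); apply/funext => n; exact: integral_semidirect_nnsfun.
rewrite -monotone_convergence//.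
- apply: eq_integral => t _; rewrite -monotone_convergence//.
  + by apply: eq_integral => u _; apply/cvg_lim.
  + by move=> n u _; rewrite lee_fin.
  + by move=> u _ n m; exact: nd_f.
- by move=> n; apply: (measurable_integral (mf_ n)) => z; rewrite lee_fin.
- by move=> n t _; apply: integral_ge0 => u _; rewrite lee_fin.
- move=> t _ n m nm; apply: ge0_le_integral => //.
  + by move=> u _; rewrite lee_fin.
  + by move=> u _; exact: nd_f.
Qed.

End integral_semidirect.

(** * Continuous test functions *)

Section continuous_test_functions.
Context (R : realType) dX (X : borelType dX).
Hypothesis normalX : perfectly_normal R X.

Lemma measurable_continuous (v : X -> R) : continuous v ->
  measurable_fun setT (EFin \o v).
Proof.
move=> cv; apply/measurable_EFinP.
apply: (measurability _ (RGenOInfty.measurableE R)) => _ [_ [a ->] <-].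
rewrite setTI; apply: measurable_open; apply: open_comp => [x _|];
  first exact: cv.
exact: interval_open.
Qed.

(** The functions [Num.min (n%:R * phi) 1] increase to the indicator of the open
    set where [phi] is positive. *)
Lemma continuous_tests_eq (P Q : probability X R) :
  (forall v : X -> R, continuous v -> (forall x, 0 <= v x <= 1)%R ->
    \int[P]_x (v x)%:E = \int[Q]_x (v x)%:E) ->
  forall B, measurable B -> P B = Q B.
Proof.
move=> PQ; apply: (measure_unique (@open X) (fun=> setT)).
- exact: borelE.
- exact: openI.
- by move=> _; exact: openT.
- by apply/seteqP; split => // x _; exists 0%N.
- move=> V oV; have [phi [cphi phi01 VE]] := normalX oV.
  pose v n x : R := Num.min (n%:R * phi x)%R 1%R.
  have cv n : continuous (v n).
    move=> x.
    apply: (@continuous_min R X (fun x => n%:R * phi x)%R (cst 1%R) x).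
      by apply: continuousM; [exact: cst_continuous|exact: cphi].
    exact: cst_continuous.
  have v01 n x : (0 <= v n x <= 1)%R.
    have /andP[p0 _] := phi01 x.
    by rewrite le_min ler01 mulr_ge0//= ge_min lexx orbT.
  have limE (S : probability X R) :
      limn (fun n => \int[S]_x (v n x)%:E) = S V.
    rewrite -monotone_convergence//; last 3 first.
    - by move=> n; exact: measurable_continuous.
    - by move=> n x _; rewrite lee_fin; case/andP: (v01 n x).
    - move=> x _ n k nk; rewrite lee_fin le_min ge_min ge_min lexx orbT andbT.
      apply/orP; left; rewrite ler_wpM2r ?ler_nat//.
      by case/andP: (phi01 x).
    have mV : measurable V by exact: measurable_open.
    have := integral_indic S measurableT mV; rewrite setIT => <-.
    apply: eq_integral => x _.
    apply/cvg_lim => //; apply: cvg_near_cst.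
    rewrite indicE; have [|] := boolP (x \in V).
      rewrite inE {1}VE /= => px; near=> n; rewrite /v min_r//.
      rewrite -ler_pdivrMr// mul1r; near: n.
      exact: nbhs_infty_ger.
    move/negP; rewrite inE {1}VE /= => /negP; rewrite -leNgt => px.
    have px0 : phi x = 0%R by apply/eqP; rewrite eq_le px; case/andP: (phi01 x).
    by near=> n; rewrite /v px0 mulr0 min_l.
  have := limE P; have := limE Q => /= <- <-; congr (limn _); apply/funext => n.
  by apply: PQ; [exact: cv|exact: v01].
- by move=> _; rewrite -[ltLHS]/(P setT) probability_setT ltry.
Unshelve. all: by end_near. Qed.

End continuous_test_functions.

Lemma continuous_lower_semicontinuous (R : realType) (S : topologicalType)
  (f : S -> R) : continuous f -> lower_semicontinuous (EFin \o f).
Proof.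
move=> cf; apply/lower_semicontinuousP => a.
rewrite (_ : [set x | _] = f @^-1` [set y | (a < y)%R]); last first.
  by apply/seteqP; split => x /=; rewrite lte_fin.
by apply: open_comp => [x _|]; [exact: cf|exact: open_gt].
Qed.

Section conditionM_consequences.
Context (R : realType) dX dA (X : borelType dX) (A : borelType dA) (d : nat).
Variable M : cmdp R X A d.
Variable Gam : nat -> set (X * A).
Hypothesis MM : conditionM M Gam.

Lemma majorized_lsc_cost i : majorized_lsc M Gam (cost M i).
Proof.
move=> j; have [V [D [nu [oV GV cD dom [_ lc]]]]] := MM j.
by exists V, D, nu; split.
Qed.

Lemma majorized_lsc_state (v : X -> R) : continuous v ->
  majorized_lsc M Gam (fun z => (v z.1)%:E).
Proof.
move=> cv j; have [V [D [nu [oV GV cD dom _]]]] := MM j.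
exists V, D, nu; split => //.
apply: continuous_lower_semicontinuous; apply: continuous_subspaceT => z.
by apply: continuous_comp; [exact: cvg_fst|exact: cv].
Qed.

Lemma majorized_lsc_next (v : X -> R) : continuous v ->
  (forall x, 0 <= v x <= 1)%R ->
  majorized_lsc M Gam (next_integral M (EFin \o v)).
Proof.
move=> cv v01 j; have [V [D [nu [oV GV cD dom [cq _]]]]] := MM j.
exists V, D, nu; split => //.
have bv : exists K : R, forall x, (`|v x| <= K)%R.
  by exists 1%R => x; have /andP[v0 v1] := v01 x; rewrite ger0_norm.
pose w : bounded_continuous R X := exist _ v (conj cv bv).
have -> : next_integral M (EFin \o v) =
    EFin \o (fun z => test_integrals (kernel_point (transition M) z) w).
  apply/funext => z; rewrite /= /test_integrals /Rintegral fineK//.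
  apply: integrable_fin_num => //.
  apply: measurable_bounded_integrable => //.
  - by rewrite /= (probability_fine (kernel_point (transition M) z)) ?ltry.
  - exact/measurable_EFinP/measurable_continuous.
  - exists 1%R; split => // K K1 x _ /=; apply: le_trans (ltW K1).
    by have /andP[v0 v1] := v01 x; rewrite ger0_norm.
apply: continuous_lower_semicontinuous => z.
apply: (@continuous_comp (subspace (D `*` [set: A])) (weak_probability R X) R
  (fun z => kernel_point (transition M) z) (fun p => test_integrals p w)).
  exact: cq.
apply: (@continuous_comp (weak_probability R X) _ R
  (@test_integrals R _ X) (fun f => f w)).
  exact: initial_continuous.
pose I : eqType := HB.pack (bounded_continuous R X)
  (gen_eqMixin (bounded_continuous R X)).
exact: (@proj_continuous I (fun=> R) w).
Qed.

End conditionM_consequences.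

(** * Invariance of the limit measure *)

HB.instance Definition _ d1 d2 (T1 : measurableType d1)
  (T2 : measurableType d2) :=
  isMeasurableFun.Build _ _ _ _ (@fst T1 T2) measurable_fst.

HB.instance Definition _ d1 d2 (T1 : measurableType d1)
  (T2 : measurableType d2) :=
  isMeasurableFun.Build _ _ _ _ (@snd T1 T2) measurable_snd.

Lemma integral_markov d (T : measurableType d) (R : realType)
    (mu : {measure set T -> \bar R}) (f : T -> \bar R) (S : set T) (c : R) :
  measurable_fun setT f -> (forall x, 0 <= f x) -> measurable S ->
  (0 <= c)%R -> (forall x, S x -> c%:E <= f x) ->
  c%:E * mu S <= \int[mu]_x f x.
Proof.
move=> mf f0 mS c0 cf; rewrite -[S in mu S]setTI -integral_cst//; last first.
  exact: measurableI.
apply: (@le_trans _ _ (\int[mu]_(x in setT `&` S) f x)).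
  rewrite setTI; apply: ge0_le_integral => //.
  exact: measurable_funTS.
by apply: ge0_subset_integral => //; exact: measurableI.
Qed.

Definition next_law (R : realType) dX dA (X : measurableType dX)
    (A : measurableType dA) (q : R.-pker (X * A) ~> X)
    (P : probability (X * A)%type R) (B : set X) : \bar R :=
  \int[P]_z q z B.

Section next_law.
Context (R : realType) dX dA (X : measurableType dX) (A : measurableType dA).
Variables (q : R.-pker (X * A) ~> X) (P : probability (X * A)%type R).

Lemma next_lawE B : measurable B ->
  next_law q P B = distribution (semidirect P q) snd B.
Proof.
move=> mB; apply: eq_integral => z _; congr (q z _).
by apply/seteqP; split => x; rewrite /xsection/= inE.
Qed.

Lemma integral_next_law (v : X -> \bar R) : measurable_fun setT v ->
  (forall x, 0 <= v x) ->
  \int[distribution (semidirect P q) snd]_x v x = \int[P]_z \int[q z]_x v x.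
Proof.
move=> mv v0; rewrite ge0_integral_distribution// integral_semidirect//.
  exact: measurableT_comp mv measurable_snd.
by move=> z; exact: v0.
Qed.

End next_law.

Section unit_integrals.
Context d (T : measurableType d) (R : realType) (P : probability T R).
Variable f : T -> R.
Hypotheses (mf : measurable_fun setT (EFin \o f)).
Hypothesis f01 : forall x, (0 <= f x <= 1)%R.

Let f_ge0 x : (0 <= f x)%R. Proof. by case/andP: (f01 x). Qed.

Let cf_ge0 x : (0 <= 1 - f x)%R.
Proof. by rewrite subr_ge0; case/andP: (f01 x). Qed.

Let mcf : measurable_fun setT (EFin \o (fun x => 1 - f x)%R).
Proof. by apply/measurable_EFinP; apply: measurable_funB => //;
  exact/measurable_EFinP. Qed.

Lemma integral_unit_complD :
  \int[P]_x (1 - f x)%:E + \int[P]_x (f x)%:E = 1.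
Proof.
rewrite -ge0_integralD//; [|by move=> *; rewrite lee_fin..].
under eq_integral do rewrite -EFinD subrK.
by rewrite integral_cst// mul1e; exact: probability_setT.
Qed.

Lemma integral_unit_le1 : \int[P]_x (f x)%:E <= 1.
Proof.
rewrite -[leRHS]integral_unit_complD leeDr//.
by apply: integral_ge0 => x _; rewrite lee_fin.
Qed.

Lemma integral_unit_fin_num : \int[P]_x (f x)%:E \is a fin_num.
Proof.
rewrite ge0_fin_numE; last by apply: integral_ge0 => x _; rewrite lee_fin.
by apply: le_lt_trans integral_unit_le1 _; rewrite ltry.
Qed.

Lemma integral_unit_compl :
  \int[P]_x (1 - f x)%:E = 1 - \int[P]_x (f x)%:E.
Proof. by rewrite -integral_unit_complD addeK// integral_unit_fin_num. Qed.

End unit_integrals.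

Section limit_measure.
Context (R : realType) dX dA (X : borelType dX) (A : borelType dA) (d : nat).
Variable M : cmdp R X A d.
Variable Gam : nat -> set (X * A).
Hypotheses (MSU : conditionSU M Gam) (MM : conditionM M Gam).
Variables (g : nat -> probability (X * A)%type R) (delta : nat -> R).
Hypotheses (delta0 : delta n @[n --> \oo] --> 0%R).
Hypothesis g_near : forall n, near_invariant M (g n) (delta n).
Hypothesis g_graph : forall n, g n (admissible_graph M) = 1.
Hypothesis g_cost : forall i, exists C : R,
  \forall n \near \oo, \int[g n]_z cost M i z <= C%:E.

Let countA := action_countable M.
Let discreteA := action_discrete M.

Let metrizableX : metrizable R X.
Proof. by case: (state_borel M). Qed.

Let normalX : perfectly_normal R X.
Proof. exact: metrizable_perfectly_normal. Qed.

Let compact_Gam j : compact (Gam j). Proof. by case: MSU. Qed.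

Let closed_Gam j : closed (Gam j).
Proof. by apply: compact_closed => //; exact: (@discrete_prod_hausdorff R). Qed.

Let mGam j : measurable (Gam j).
Proof.
rewrite -[Gam j]setCK; apply: measurableC; apply: measurable_open_prod => //.
exact: closed_openC.
Qed.

(** Markov's inequality for the cost that is strictly unbounded. *)
Let tight (U : set_system nat) (m : set (X * A) -> R) : ProperFilter U ->
  \oo `<=` U -> setwise_limit U g m ->
  forall e : R, (0 < e)%R -> exists j, (1 - e <= m (Gam j))%R.
Proof.
move=> UP Uoo gm e e0; have [_ _ _ [i infi]] := MSU.
(* The maximum makes the bound positive, so that [C / e] grows as [e]
   shrinks. *)
have [C0 gC0] := g_cost i; pose C := Num.max C0 1%R.
have C_gt0 : (0 < C)%R by rewrite lt_max ltr01 orbT.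
have : \forall j \near \oo,
  (C / e)%:E <= ereal_inf [set cost M i z | z in ~` Gam j].
  by move/cvgeyPge : infi; apply; rewrite num_real.
move=> /filter_ex[j jC]; exists j.
apply: (ler_cvg_to (cvg_cst _) (gm _ (mGam j))).
apply: Uoo; apply: filterS gC0 => n nC0.
have mS : measurable (~` Gam j) by exact: measurableC.
have Ce : (0 <= C / e)%R by rewrite divr_ge0// ltW.
have := @integral_markov _ _ _ (g n) _ _ _ (measurable_cost M i)
  (cost_ge0 M i) mS Ce.
move=> /(_ _)/le_trans => /(_ C%:E).
rewrite -lee_fin EFinB -probability_fine// => H.
have {H} : (C / e)%:E * g n (~` Gam j) <= C%:E.
  apply: H; last by apply: le_trans nC0 _; rewrite lee_fin le_max lexx.
  by move=> z nz; apply: le_trans jC _; apply: ereal_inf_lbound; exists z.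
rewrite (probability_fine (g n) mS) -EFinM lee_fin mulrAC ler_pdivrMr//.
rewrite ler_pM2l// -lee_fin -probability_fine// probability_setC//.
by rewrite (probability_fine (g n)
  (mGam j)) -!EFinB !lee_fin lerBlDl lerBlDr addrC.
Qed.

Section invariance.
Variables (U : set_system nat) (P : probability (X * A)%type R).
Hypotheses (UU : UltraFilter U) (deltaU : delta n @[n --> U] --> 0%R).
Hypothesis lim_le : forall f C, measurable_fun setT f -> (forall z, 0 <= f z) ->
  majorized_lsc M Gam f ->
  (\forall n \near U, \int[g n]_z f z <= C) -> \int[P]_z f z <= C.

(** Both [v] after a transition and [1 - v] before it satisfy
    [near_limit_integral_le], and near invariance makes their integrals add up
    to about [1]. *)
Let next_le (v : X -> R) : continuous v -> (forall x, 0 <= v x <= 1)%R ->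
  \int[P]_z next_integral M (EFin \o v) z <= \int[P]_z (v z.1)%:E.
Proof.
move=> cv v01; have UP : ProperFilter U by exact: ultra_proper.
have mv := measurable_continuous cv.
have mv1 : measurable_fun setT (EFin \o (v \o fst) : X * A -> \bar R).
  exact: measurableT_comp mv measurable_fst.
have v1_01 (z : X * A) : (0 <= (v \o fst) z <= 1)%R by exact: v01.
have v_ge0 x : 0 <= (EFin \o v) x by rewrite lee_fin; case/andP: (v01 x).
pose u n := fine (\int[g n]_z (v z.1)%:E).
have uE n : \int[g n]_z (v z.1)%:E = (u n)%:E.
  by rewrite fineK//; exact: integral_unit_fin_num mv1 v1_01.
have [|l ul] := ultra_cvg_unit UU (u := u).
  move=> n; rewrite -!lee_fin -uE integral_unit_le1// andbT.
  by apply: integral_ge0 => z _; exact: v_ge0.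
apply/lee_addgt0Pr => e e0; have e20 : (0 < e / 2)%R by rewrite divr_gt0.
have : \int[P]_z next_integral M (EFin \o v) z <= (l + e / 2)%:E.
  apply: lim_le; [exact: measurable_next_integral| |exact: majorized_lsc_next|].
    by move=> z; apply: integral_ge0 => x _; exact: v_ge0.
  have : (u n + delta n)%R @[n --> U] --> (l + 0)%R by exact: cvgD.
  rewrite addr0 => /cvgr_le/(_ (l + e / 2)%R); rewrite ltrDl => /(_ e20).
  apply: filterS => n le_n; have [|+ _] := g_near n mv.
    by move=> x; rewrite /= !lee_fin; exact: v01.
  by move=> /le_trans; apply; rewrite uE -EFinD lee_fin.
have : \int[P]_z (1 - v z.1)%:E <= (1 - l + e / 2)%:E.
  apply: lim_le.
  - apply/measurable_EFinP; apply: measurable_funB => //.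
    exact/measurable_EFinP.
  - by move=> z; rewrite lee_fin subr_ge0; case/andP: (v01 z.1).
  - apply: (@majorized_lsc_state _ _ _ _ _ _ M Gam MM
    (fun x => 1 - v x)%R) => x.
    by apply: continuousB; [exact: cst_continuous|exact: cv].
  have /cvgr_ge/(_ (l - e / 2)%R) := ul; rewrite gtrBl => /(_ e20).
  apply: filterS => n le_n.
  rewrite (integral_unit_compl (g n) mv1 v1_01) /= uE -EFinB lee_fin.
  by lra.
have := integral_unit_compl P mv1 v1_01; rewrite /= => ->.
have vfin := integral_unit_fin_num P mv1 v1_01.
rewrite -(fineK vfin) /= -EFinB lee_fin => lv /le_trans; apply.
by rewrite -EFinD lee_fin; lra.
Qed.

(** Applying [next_le] to [1 - v] as well gives equality for continuous [v]. *)
Lemma limit_next_law B : measurable B ->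
  next_law (transition M) P B = P (fst @^-1` B).
Proof.
move=> mB; rewrite next_lawE//.
rewrite -[RHS]/(distribution P fst B).
apply: continuous_tests_eq mB => // v cv v01.
have mv := measurable_continuous cv.
have v_ge0 x : 0 <= (EFin \o v) x by rewrite lee_fin; case/andP: (v01 x).
rewrite (integral_next_law (transition M) P mv v_ge0).
rewrite (ge0_integral_distribution fst mv v_ge0).
apply/eqP; rewrite eq_le next_le//=.
have mv1 : measurable_fun setT (EFin \o (v \o fst) : X * A -> \bar R).
  exact: measurableT_comp mv measurable_fst.
have v1_01 (z : X * A) : (0 <= (v \o fst) z <= 1)%R by exact: v01.
have qE z : next_integral M (EFin \o v) z =
    (fine (next_integral M (EFin \o v) z))%:E.
  rewrite fineK//.
  exact: (integral_unit_fin_num (kernel_point (transition M) z) mv v01).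
pose w z := fine (next_integral M (EFin \o v) z).
have w01 z : (0 <= w z <= 1)%R.
  rewrite -!lee_fin -qE.
  rewrite (integral_unit_le1 (kernel_point (transition M) z) mv v01) andbT.
  exact: integral_ge0.
have mw : measurable_fun setT (EFin \o w).
  rewrite (_ : _ \o _ = next_integral M (EFin \o v)); last first.
    by apply/funext => z; rewrite qE.
  exact: measurable_next_integral.
have := @next_le (fun x => 1 - v x)%R.
rewrite (_ : next_integral M (EFin \o _) = (fun z => (1 - w z)%:E)); last first.
  apply/funext => z; rewrite EFinB -qE.
  exact: (integral_unit_compl (kernel_point (transition M) z) mv v01).
rewrite (integral_unit_compl P mw w01) (integral_unit_compl P mv1 v1_01).
have wE : \int[P]_z (w z)%:E = \int[P]_z next_integral M (EFin \o v) z.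
  by apply: eq_integral => z _; rewrite -qE.
have := integral_unit_fin_num P mv1 v1_01.
have := integral_unit_fin_num P mw w01.
rewrite wE /= => wfin vfin le_compl.
suff : \int[P]_z (v z.1)%:E <= \int[P]_z next_integral M (EFin \o v) z by [].
have := le_compl _ _; rewrite -(fineK vfin) -(fineK wfin) -!EFinB !lee_fin.
rewrite lerD2l lerN2; apply.
  by move=> x; apply: continuousB; [exact: cst_continuous|exact: cv].
by move=> x; have /andP[? ?] := v01 x; apply/andP; split; lra.
Qed.

End invariance.

Theorem limit_invariant_measure : exists P : probability (X * A)%type R,
  [/\ P (admissible_graph M) = 1,
      forall B, measurable B -> next_law (transition M) P B = P (fst @^-1` B) &
      forall i C, (\forall n \near \oo, \int[g n]_z cost M i z <= C) ->
        \int[P]_z cost M i z <= C].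
Proof.
have [U [UU Uoo]] : exists U, UltraFilter U /\ \oo `<=` U.
  exact: ultraFilterLemma.
have UP : ProperFilter U by exact: ultra_proper.
have [m gm] := ultra_setwise_limit g UU.
have tm := tight UP Uoo gm.
have [|P Pm] := tight_content_probability countA discreteA normalX
    (setwise_limit_content UP gm).
  by move=> e e0; have [j je] := tm e e0; exists (Gam j).
have deltaU : delta n @[n --> U] --> 0%R by apply: cvg_trans delta0 => E;
  exact: Uoo.
have lim_le := near_limit_integral_le UP deltaU g_near g_graph gm Pm normalX
  closed_Gam compact_Gam tm.
exists P; split.
- apply/eqP; rewrite eq_le probability_le1//=;
  last exact: measurable_admissible_graph.
  apply/lee_addgt0Pr => e e0.
  have [j je] := limit_tight M UP gm Pm closed_Gam tm e0.
  rewrite -leeBlDr//; apply: le_trans je _; apply: le_measure; rewrite ?inE//.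
    exact: measurable_admissible_graph.
  by have [_ <- _ _] := MSU; exact: bigcup_sup.
- by move=> B mB; exact: (limit_next_law UU deltaU lim_le).
- move=> i C iC; apply: lim_le.
  + exact: measurable_cost.
  + exact: cost_ge0.
  + exact: majorized_lsc_cost.
  + exact: Uoo.
Qed.

End limit_measure.

(** * Densities of slices and policies given by weights *)

Section action_slice.
Context (R : realType) dX dA (X : measurableType dX) (A : measurableType dA).
Variables (P : probability (X * A)%type R) (a : A).
Hypothesis ma : measurable [set a].

Definition action_slice (B : set X) : \bar R :=
  P (fst @^-1` B `&` snd @^-1` [set a]).

Let mslice B : measurable B ->
  measurable (fst @^-1` B `&` snd @^-1` [set a] : set (X * A)).
Proof. by move=> mB; exact: measurableX. Qed.

Let action_slice0 : action_slice set0 = 0.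
Proof. by rewrite /action_slice preimage_set0 set0I measure0. Qed.

Let action_slice_ge0 B : 0 <= action_slice B.
Proof. exact: measure_ge0. Qed.

Let action_slice_sigma_additive : semi_sigma_additive action_slice.
Proof.
move=> F mF tF mUF; rewrite /action_slice preimage_bigcup setI_bigcupl.
apply: measure_semi_sigma_additive.
- by move=> n; exact: mslice.
- by move=> i j _ _ [z [[Fi _] [Fj _]]]; apply: tF => //; exists z.1.
- by rewrite -setI_bigcupl -preimage_bigcup; exact: mslice.
Qed.

HB.instance Definition _ := isMeasure.Build _ _ _ action_slice
  action_slice0 action_slice_ge0 action_slice_sigma_additive.

Let action_slice_fin : fin_num_fun action_slice.
Proof. by move=> B mB; apply: fin_num_measure; exact: mslice. Qed.

HB.instance Definition _ := @Measure_isFinite.Build _ X R action_slice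
  action_slice_fin.

Lemma action_slice_density : exists f : X -> R,
  [/\ forall x, (0 <= f x)%R, measurable_fun setT f &
      forall B, measurable B ->
        action_slice B = \int[distribution P fst]_(x in B) (f x)%:E].
Proof.
have dom : action_slice `<< distribution P fst.
  apply/null_content_dominatesP => B mB PB0.
  apply/eqP; rewrite eq_le measure_ge0 andbT -PB0.
  by apply: le_measure; rewrite ?inE;
    [exact: mslice|rewrite -[X in measurable X]setTI; exact: measurable_fst|].
have [f [f0 ff intf fE]] := radon_nikodym_sigma_finite dom.
exists (fine \o f); split.
- by move=> x; exact: fine_ge0.
- by apply: measurableT_comp => //; exact: measurable_int intf.
- by move=> B mB; rewrite fE//; apply: eq_integral => x _; rewrite /= fineK.
Qed.

End action_slice.

Section weights_policy.
Context (R : realType) dX dA (X : borelType dX) (A : borelType dA) (d : nat).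
Variable M : cmdp R X A d.
Variables (e : nat -> A) (W : nat -> X -> R).
Hypotheses (W_ge0 : forall n x, (0 <= W n x)%R).
Hypothesis mW : forall n, measurable_fun setT (W n).
Hypothesis W1 : forall x, \sum_(n <oo) (W n x)%:E = 1.
Hypothesis W_admissible : forall n x, W n x != 0%R -> admissible M x (e n).

Definition weights_kernel (x : X) : {measure set A -> \bar R} :=
  mseries (fun n => mscale (NngNum (W_ge0 n x)) (\d_(e n))) 0.

Let weights_kernelE x S :
  weights_kernel x S = \sum_(n <oo) (W n x)%:E * \d_(e n) S.
Proof. by []. Qed.

Let measurable_weights_kernel S : measurable S ->
  measurable_fun setT (weights_kernel ^~ S).
Proof.
move=> mS; under eq_fun do rewrite weights_kernelE.
apply: (ge0_emeasurable_sum (P := xpredT)) => [n x _ _|n _].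
  by rewrite mule_ge0// lee_fin.
apply: emeasurable_funM; last exact: measurable_cst.
exact/measurable_EFinP.
Qed.

HB.instance Definition _ := isKernel.Build _ _ _ _ _ weights_kernel
  measurable_weights_kernel.

Let weights_kernel_prob x : weights_kernel x setT = 1.
Proof.
rewrite weights_kernelE -[RHS](W1 x); apply: eq_eseriesr => n _.
by rewrite diracT mule1.
Qed.

HB.instance Definition _ := Kernel_isProbability.Build _ _ _ _ _ weights_kernel
  weights_kernel_prob.

Let weights_kernel_admissible x : weights_kernel x (admissible M x) = 1.
Proof.
rewrite weights_kernelE -[RHS](W1 x); apply: eq_eseriesr => n _.
have [->|/W_admissible adm] := eqVneq (W n x) 0%R; first by rewrite mul0e.
by rewrite diracE mem_set// mule1.
Qed.

Definition weights_policy : stationary_policy M :=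
  @StationaryPolicy _ _ _ _ _ _ M weights_kernel weights_kernel_admissible.

End weights_policy.

(** * Disintegration into a stationary policy *)

Section disintegration.
Context (R : realType) dX dA (X : borelType dX) (A : borelType dA) (d : nat).
Variable M : cmdp R X A d.
Variable P : probability (X * A)%type R.
Hypothesis P_graph : P (admissible_graph M) = 1.

Let countA := action_countable M.
Let discreteA := action_discrete M.
Let mgraph : measurable (admissible_graph M) := measurable_admissible_graph M.
Let mA (B : set A) : measurable B := measurable_discrete discreteA B.
Let p : probability X R := distribution P fst.

Section enumeration.
Variables (rk : A -> nat) (e : nat -> A).
Hypothesis rkK : cancel rk e.
Variable f : A -> X -> R.
Hypothesis f_ge0 : forall a x, (0 <= f a x)%R.
Hypothesis mf : forall a, measurable_fun setT (f a).
Hypothesis fE : forall a B, measurable B ->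
  action_slice P a B = \int[p]_(x in B) (f a x)%:E.

(** Indices that do not enumerate an action get no weight. *)
Let mass n : set X := [set x | rk (e n) == n /\ admissible M x (e n)].

Let mmass n : measurable (mass n).
Proof.
have [E|E] := boolP (rk (e n) == n).
  rewrite (_ : mass n = [set x | admissible_graph M (x, e n)]).
    exact: measurable_slice.
  by apply/seteqP; split => [x []//|x gx]; split.
rewrite (_ : mass n = set0) //; apply/seteqP; split => x //=.
by rewrite /mass/= (negbTE E) => -[].
Qed.

Let w n x : R := (f (e n) x * \1_(mass n) x)%R.

Let w_ge0 n x : (0 <= w n x)%R. Proof. by rewrite mulr_ge0. Qed.

Let mw n : measurable_fun setT (w n).
Proof. by apply: measurable_funM => //; exact: measurable_indic. Qed.

Let wd_ge0 n x (S : set A) : 0 <= (w n x)%:E * \d_(e n) S.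
Proof. by rewrite mule_ge0// lee_fin. Qed.

Let mwd n (B : set (X * A)) : measurable B ->
  measurable_fun setT (fun x => (w n x)%:E * \d_(e n) (xsection B x)).
Proof.
move=> mB; apply: emeasurable_funM; first exact/measurable_EFinP.
rewrite (_ : (fun x => _) = EFin \o \1_[set x | B (x, e n)]).
  exact/measurable_EFinP/measurable_indic/measurable_slice.
by apply/funext => x; rewrite /= diracE indicE mem_xsection; congr (_%:R%:E).
Qed.

Let total_massE B : measurable B ->
  P B = \int[p]_x \sum_(n <oo) (w n x)%:E * \d_(e n) (xsection B x).
Proof.
move=> mB; rewrite integral_nneseries//; last by move=> n; exact: mwd.
pose F n := [set z | [/\ B z, admissible_graph M z, z.2 = e n & rk (e n) == n]].
have FE n : F n = fst @^-1` ([set x | B (x, e n)] `&` mass n) `&`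
    snd @^-1` [set e n].
  apply/seteqP; split => -[x a]/=; rewrite /F/mass/=.
    by move=> [Bx gx aE re]; move: Bx gx; rewrite aE.
  by move=> [[Bx [re gx]] ->].
have mFn n : measurable (F n).
  rewrite FE; apply: measurableX; last exact: mA.
  by apply: measurableI => //; exact: measurable_slice.
have -> : P B = P (\bigcup_n F n).
  have UF : \bigcup_n F n = B `&` admissible_graph M.
    apply/seteqP; split => [z [n _ []]//|[x a] [Bz gz]].
    by exists (rk a) => //; split; rewrite /= ?rkK.
  rewrite UF; apply/eqP; rewrite eq_le; apply/andP; split; last first.
    by apply: le_measure; rewrite ?inE//; exact: measurableI.
  rewrite -[leRHS]adde0 -[X in _ + X](_ : P (~` admissible_graph M) = 0).
    apply: le_trans (measureU2 _ _ _); [|exact: measurableI|exact: measurableC].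
    apply: le_measure; rewrite ?inE//.
      by apply: measurableU; [exact: measurableI|exact: measurableC].
    by move=> z Bz; have [?|?] := pselect (admissible_graph M z); [left|right].
  by rewrite probability_setC// P_graph subee.
rewrite measure_bigcup//; last first.
  move=> i j _ _ [z [[_ _ zi /eqP ii] [_ _ zj /eqP jj]]].
  by rewrite -ii -jj -zi -zj.
rewrite (@eq_eseriesl _ _ xpredT) => [|n]; last by rewrite in_setT.
apply: eq_eseriesr => n _; rewrite FE -[LHS]/(action_slice P (e n) _).
have mS : measurable ([set x | B (x, e n)] `&` mass n).
  by apply: measurableI => //; exact: measurable_slice.
rewrite fE// [LHS]integral_mkcond; apply: eq_integral => x _.
rewrite patchE /w EFinM -muleA diracE indicE mem_xsection -EFinM -natrM mulnb.
have -> : (x \in [set x0 | B (x0, e n)] `&` mass n) =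
    (x \in mass n) && ((x, e n) \in B).
  by rewrite in_setI andbC.
by case: ifPn => _; rewrite ?mulr1 ?mulr0.
Qed.

(** The first admissible action; it replaces the conditional law on the null
    set where the densities do not sum to [1]. *)
Let first n : set X := mass n `\` \big[setU/set0]_(k < n) mass k.

Let mfirst n : measurable (first n).
Proof. by apply: measurableD => //; exact: bigsetU_measurable. Qed.

Let first_series x : \sum_(n <oo) (\1_(first n) x)%:E = 1 :> \bar R.
Proof.
have [a adm] := admissible_neq0 M x.
have ex : exists n, `[< mass n x >].
  by exists (rk a); apply/asboolP; split; rewrite ?rkK.
have [n /asboolP nx min_n] := find_ex_minn ex.
have firstE k : first k x <-> k = n.
  rewrite /first -bigcup_mkord; split => [[kx nkx]|->].
    apply/eqP; rewrite eqn_leq min_n ?andbT; last exact/asboolP.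
    by rewrite leqNgt; apply/negP => nk; apply: nkx; exists n.
  split => // -[j /= jn jx].
  by have := min_n j; rewrite leqNgt jn => /(_ (asboolT jx)).
rewrite (@nneseriesD1 _ _ n)//.
rewrite eseries0 => [|k _ /= kn].
  by rewrite adde0 indicE mem_set//; exact/firstE.
by rewrite indicE memNset// => /firstE kE; rewrite kE eqxx in kn.
Qed.

Let good : set X := [set x | \sum_(n <oo) (w n x)%:E = 1].

Let mgood : measurable good.
Proof.
rewrite -[good]setTI; apply: measurable_eqe => //.
apply: (ge0_emeasurable_sum (P := xpredT)) => [n x _ _|n _].
  by rewrite lee_fin.
exact/measurable_EFinP.
Qed.

Let W n x : R := if x \in good then w n x else \1_(first n) x.

Let W_ge0 n x : (0 <= W n x)%R.
Proof. by rewrite /W; case: ifP. Qed.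

Let mW n : measurable_fun setT (W n).
Proof.
apply: measurable_fun_ifT => //.
apply: (measurable_fun_bool true); rewrite setTI.
rewrite (_ : _ @^-1` _ = good)//.
by apply/seteqP; split => y; [move/set_mem|move/mem_set].
Qed.

Let W1 x : \sum_(n <oo) (W n x)%:E = 1.
Proof.
have [xg|xg] := boolP (x \in good).
  by rewrite -[RHS](set_mem xg); apply: eq_eseriesr => n _; rewrite /W xg.
rewrite -[RHS](first_series x); apply: eq_eseriesr => n _.
by rewrite /W (negbTE xg).
Qed.

Let W_admissible n x : W n x != 0%R -> admissible M x (e n).
Proof.
rewrite /W; case: ifPn => _.
  rewrite /w indicE; have [/set_mem[]//|_] := boolP (x \in mass n).
  by rewrite mulr0 eqxx.
rewrite indicE; have [/set_mem[[]]//|_] := boolP (x \in first n).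
by rewrite eqxx.
Qed.

(** By [total_massE] on the sets [C `*` setT], the integral of the sum of the
    densities over [C] is [p C]. *)
Let good_ae : ae_eq p setT (cst 1) (fun x => \sum_(n <oo) (w n x)%:E).
Proof.
apply: integral_ae_eq => //.
- exact: finite_measure_integrable_cst.
- apply: (ge0_emeasurable_sum (P := xpredT)) => [n x _ _|n _].
    by rewrite lee_fin.
  exact/measurable_EFinP.
move=> C _ mC; have mC1 : measurable (C `*` setT : set (X * A)).
  exact: measurableX.
rewrite integral_cst// mul1e -[LHS]/(P (fst @^-1` C)).
have -> : fst @^-1` C = C `*` setT :> set (X * A).
  by apply/seteqP; split => z // -[].
rewrite total_massE// [RHS]integral_mkcond; apply: eq_integral => x _.
rewrite patchE; case: ifPn => xC.
  apply: eq_eseriesr => n _; rewrite diracE mem_set ?mule1//.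
  by apply/mem_set; split => //=; exact: set_mem.
apply: eseries0 => n _ _; rewrite diracE memNset ?mule0//.
by rewrite /xsection/= inE => -[/= /mem_set]; rewrite (negbTE xC).
Qed.

Lemma disintegration_enum : exists mu : stationary_policy M,
  forall B, measurable B -> P B = semidirect p (stationary_kernel mu) B.
Proof.
exists (weights_policy W_ge0 mW W1 W_admissible) => B mB.
rewrite total_massE// /semidirect.
apply: ge0_ae_eq_integral => //.
- exact: (ge0_emeasurable_sum (P := xpredT)) (fun n _ => mwd n mB).
- by apply: measurable_fun_xsection_finite_kernel; rewrite inE.
- by move=> x _; apply: nneseries_ge0.
case: good_ae => N [mN N0 badN]; exists N; split => // x /= bad; apply: badN.
apply: contra_not bad => + _ => /(_ I) gx.
apply: eq_eseriesr => n _.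
have WE : W n x = w n x by rewrite /W mem_set.
by rewrite -[RHS]/((W n x)%:E * \d_(e n) (xsection B x)) WE.
Qed.

End enumeration.

(** Since the actions are countable, conditional laws are Radon-Nikodym
    derivatives of the slices of [P], taken action by action. *)
Theorem disintegration : exists mu : stationary_policy M,
  forall B, measurable B ->
    P B = semidirect (distribution P fst) (stationary_kernel mu) B.
Proof.
have /countable_injP[rk rk_inj] := countA.
pose e n := xget point [set a | rk a = n].
have rkK : cancel rk e.
  move=> a; rewrite /e; case: xgetP => [b _ /= rkb|/(_ a)[]//].
  by apply: rk_inj; rewrite ?inE.
have /choice[f fP] := fun a => action_slice_density P (mA [set a]).
apply: (@disintegration_enum rk e rkK f) => a.
- by have [] := fP a.
- by have [] := fP a.
- by have [] := fP a.
Qed.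

End disintegration.

(** * Laws of histories and occupation measures *)

Section stationary_pairs.
Context (R : realType) dX dA (X : borelType dX) (A : borelType dA) (d : nat).
Variable M : cmdp R X A d.

Lemma semidirect_graph (mu : stationary_policy M) (p : probability X R) :
  semidirect p (stationary_kernel mu) (admissible_graph M) = 1.
Proof.
rewrite /semidirect (eq_integral (cst 1)).
  by rewrite integral_cst// mul1e; exact: probability_setT.
move=> x _; transitivity (stationary_kernel mu x (admissible M x)).
  congr (stationary_kernel mu x _).
  by apply/seteqP; split => a; rewrite /xsection/= inE.
exact: stationary_admissible.
Qed.

Lemma integral_kcomp_semidirect (mu : stationary_policy M) (p : probability X R)
    B : measurable B ->
  \int[p]_x kcomp (stationary_kernel mu) (transition M) x B =
  next_law (transition M) (semidirect p (stationary_kernel mu)) B.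
Proof.
move=> mB; rewrite /next_law integral_semidirect//.
exact: measurable_kernel.
Qed.

Lemma invariant_disintegration (P : probability (X * A)%type R) :
  P (admissible_graph M) = 1 ->
  (forall B, measurable B -> next_law (transition M) P B = P (fst @^-1` B)) ->
  exists (mu : stationary_policy M) (p : probability X R),
    invariant_probability mu p /\
    forall f, \int[P]_z f z = \int[semidirect p (stationary_kernel mu)]_z f z.
Proof.
move=> P1 PB; have [mu muP] := disintegration P1.
have intE f : \int[P]_z f z =
    \int[semidirect (distribution P fst) (stationary_kernel mu)]_z f z.
  by apply: eq_measure_integral => B mB _; exact: muP.
exists mu, (distribution P fst); split => // B mB.
by rewrite integral_kcomp_semidirect// /next_law -intE; exact: PB.
Qed.

Lemma integral_next_invariant (mu : stationary_policy M) (p : probability X R)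
    (v : X -> \bar R) :
  invariant_probability mu p -> measurable_fun setT v -> (forall x, 0 <= v x) ->
  \int[semidirect p (stationary_kernel mu)]_z next_integral M v z =
  \int[p]_x v x.
Proof.
move=> inv mv v0; rewrite -(integral_next_law (transition M) _ mv v0).
apply: eq_measure_integral => B mB _.
rewrite -[RHS]inv// integral_kcomp_semidirect//.
by rewrite next_lawE.
Qed.

Lemma near_invariant_stationary (mu : stationary_policy M)
    (p : probability X R) : invariant_probability mu p ->
  near_invariant M (semidirect p (stationary_kernel mu)) 0%R.
Proof.
move=> inv v mv v01; have v0 x : 0 <= v x by case/andP: (v01 x).
rewrite integral_next_invariant// integral_semidirect//; last first.
  exact: measurableT_comp mv measurable_fst.
rewrite (_ : (\int[p]_t \int[_]_u _) = \int[p]_x v x) ?adde0//.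
apply: eq_integral => x _ /=.
by rewrite integral_cst// -[X in _ * X]/(stationary_kernel mu x setT)
  prob_kernel mule1.
Qed.

End stationary_pairs.

Section history_laws.
Context (R : realType) dX dA (X : borelType dX) (A : borelType dA) (d : nat).
Variables (M : cmdp R X A d) (pi : policy M) (zeta : probability X R).

Let S n : probability (history X A n * A)%type R :=
  semidirect (history_law pi zeta n) (policy_kernel pi n).

(** The law of [(x_n, a_n)]. *)
Definition stage_law n : probability (X * A)%type R :=
  distribution (S n) (@last_pair _ _ X A n).

Let integral_semidirect_fst d1 d2 (T1 : measurableType d1)
    (T2 : measurableType d2) (P : probability T1 R) (k : R.-pker T1 ~> T2)
    (f : T1 -> \bar R) : measurable_fun setT f -> (forall t, 0 <= f t) ->
  \int[semidirect P k]_z f z.1 = \int[P]_t f t.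
Proof.
move=> mf f0; rewrite (@integral_semidirect _ _ _ _ _ _ _ (f \o fst))//.
- apply: eq_integral => t _ /=.
  by rewrite integral_cst// -[X in _ * X]/(k t setT) prob_kernel mule1.
- exact: measurableT_comp mf measurable_fst.
- by move=> z; exact: f0.
Qed.

Let measurable_stage_sum n (f : X * A -> \bar R) : measurable_fun setT f ->
  measurable_fun setT
    (fun h : history X A n => \sum_(k < n) f (tnth h.1 k)).
Proof.
move=> mf; apply: emeasurable_sum => k.
apply: (measurableT_comp mf).
exact: (measurableT_comp (measurable_tnth k) measurable_fst).
Qed.

Lemma integral_history_law n (f : X * A -> \bar R) :
  measurable_fun setT f -> (forall z, 0 <= f z) ->
  \int[history_law pi zeta n]_h \sum_(k < n) f (tnth h.1 k) =
  \sum_(k < n) \int[stage_law k]_z f z.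
Proof.
move=> mf f0; elim: n => [|n ih].
  under eq_integral do rewrite big_ord0.
  by rewrite integral0 big_ord0.
rewrite big_ord_recr/= -ih ge0_integral_distribution//; last 2 first.
- exact: measurable_stage_sum.
- by move=> h; exact: sume_ge0.
pose F n (h : history X A n) := \sum_(k < n) f (tnth h.1 k).
have mF : measurable_fun setT (F n) by exact: measurable_stage_sum.
have F0 h : 0 <= F n h by exact: sume_ge0.
have mlast : measurable_fun setT (f \o @last_pair _ _ X A n).
  exact: measurableT_comp mf (@measurable_last_pair _ _ X A n).
have mFS : measurable_fun setT (fun z : history X A n * A => F n z.1).
  exact: measurableT_comp mF measurable_fst.
rewrite (eq_integral (fun w : history X A n * A * X =>
    F n w.1.1 + f (last_pair w.1))); last first.
  move=> [[[t x] a] y] _ /=; rewrite big_ord_recr/=; congr (_ + f _).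
    apply: eq_bigr => k _; congr f.
    by rewrite !(tnth_nth (x, a))/= nth_rcons size_tuple ltn_ord.
  by rewrite (tnth_nth (x, a))/= nth_rcons size_tuple ltnn eqxx.
rewrite (integral_semidirect_fst _ _ (f := fun z => F n z.1 + f
  (last_pair z))); last 2 first.
- exact: emeasurable_funD.
- by move=> z; rewrite adde_ge0.
rewrite ge0_integralD//; congr (_ + _).
  exact: integral_semidirect_fst.
by rewrite ge0_integral_distribution.
Qed.

Let state_integral n (v : X -> \bar R) := \int[history_law pi zeta n]_h v h.2.

Lemma integral_stage_state n v : measurable_fun setT v ->
  (forall x, 0 <= v x) ->
  \int[stage_law n]_z v z.1 = state_integral n v.
Proof.
move=> mv v0; rewrite ge0_integral_distribution//; last first.
  exact: measurableT_comp mv measurable_fst.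
rewrite (integral_semidirect_fst _ _ (f := fun h => v h.2))//.
exact: measurableT_comp mv measurable_snd.
Qed.

Lemma integral_stage_next n v : measurable_fun setT v -> (forall x, 0 <= v x) ->
  \int[stage_law n]_z next_integral M v z = state_integral n.+1 v.
Proof.
move=> mv v0; rewrite ge0_integral_distribution//; last 2 first.
- exact: measurable_next_integral.
- by move=> z; exact: integral_ge0.
rewrite /state_integral ge0_integral_distribution//; last first.
  exact: measurableT_comp mv measurable_snd.
rewrite (integral_semidirect _ _ (f := fun w => v w.2))//.
exact: measurableT_comp mv measurable_snd.
Qed.

Lemma stage_law_graph n : stage_law n (admissible_graph M) = 1.
Proof.
rewrite -[LHS]/(\int[_]_h policy_kernel pi n h _) (eq_integral (cst 1)).
  by rewrite integral_cst// mul1e; exact: probability_setT.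
move=> h _; transitivity (policy_kernel pi n h (admissible M h.2)).
  congr (policy_kernel pi n h _).
  by apply/seteqP; split => a; rewrite /xsection/= inE.
exact: policy_admissible.
Qed.

Let inv_ge0 n : (0 <= n.+1%:R^-1 :> R)%R. Proof. by rewrite invr_ge0. Qed.

Definition occupation n : set (X * A) -> \bar R :=
  mscale (NngNum (inv_ge0 n)) (msum stage_law n.+1).

HB.instance Definition _ n := Measure.on (occupation n).

Let sum1 n : (n.+1%:R^-1)%:E * \sum_(k < n.+1) 1 = 1 :> \bar R.
Proof.
rewrite sumEFin sumr_const card_ord -EFinM -[X in (_ * X)%R]/(n.+1%:R%R).
by rewrite mulVf// pnatr_eq0.
Qed.

Let occupation_prob n : occupation n setT = 1.
Proof.
rewrite /occupation /mscale/= /msum -[RHS](sum1 n); congr (_ * _).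
by apply: eq_bigr => k _; exact: probability_setT.
Qed.

HB.instance Definition _ n := Measure_isProbability.Build _ _ _ (occupation n)
  (occupation_prob n).

Lemma integral_occupation n f : measurable_fun setT f -> (forall z, 0 <= f z) ->
  \int[occupation n]_z f z =
  (n.+1%:R^-1)%:E * \sum_(k < n.+1) \int[stage_law k]_z f z.
Proof.
move=> mf f0; rewrite ge0_integral_mscale//; congr (_ * _).
exact: ge0_integral_measure_sum.
Qed.

Lemma occupation_graph n : occupation n (admissible_graph M) = 1.
Proof.
rewrite /occupation /mscale/= /msum -[RHS](sum1 n); congr (_ * _).
by apply: eq_bigr => k _; exact: stage_law_graph.
Qed.

(** The next state at one stage is the current state at the following one, so
    the sum of the differences over the stages telescopes to a difference of
    two integrals of [v]. *)
Lemma near_invariant_occupation n :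
  near_invariant M (occupation n) n.+1%:R^-1.
Proof.
move=> v mv v01; have v0 x : 0 <= v x by case/andP: (v01 x).
have mv1 : measurable_fun setT (fun z : X * A => v z.1).
  exact: measurableT_comp mv measurable_fst.
have mnext := measurable_next_integral M mv v0.
have next0 z : 0 <= next_integral M v z by exact: integral_ge0.
rewrite !integral_occupation//.
have bound (x y : \bar R) : 0 <= y -> x <= y + 1 ->
    (n.+1%:R^-1)%:E * x <= (n.+1%:R^-1)%:E * y + (n.+1%:R^-1)%:E.
  move=> y0 xy; rewrite -[X in _ + X]mule1 -ge0_muleDr//.
  by apply: lee_wpmul2l => //; rewrite lee_fin.
have a0 k : 0 <= state_integral k v by exact: integral_ge0.
have a1 k : state_integral k v <= 1.
  rewrite /state_integral -(probability_setT (history_law pi zeta k)).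
  rewrite -[leRHS]mul1e -integral_cst//; apply: ge0_le_integral => //.
  - exact: measurableT_comp mv measurable_snd.
  - by move=> h _; case/andP: (v01 h.2).
under eq_bigr do rewrite integral_stage_next//.
have -> : \sum_(k < n.+1) \int[stage_law k]_z v z.1 =
    \sum_(k < n.+1) state_integral k v.
  by apply: eq_bigr => k _; exact: integral_stage_state.
have sumS : \sum_(k < n.+1) state_integral k v + state_integral n.+1 v =
    state_integral 0 v + \sum_(k < n.+1) state_integral k.+1 v.
  transitivity (\sum_(k < n.+2) state_integral k v).
    by rewrite [RHS]big_ord_recr.
  by rewrite [LHS]big_ord_recl.
split; apply: bound; [exact: sume_ge0| |exact: sume_ge0|].
- apply: (@le_trans _ _ (\sum_(k < n.+1) state_integral k v +
    state_integral n.+1 v)); last by rewrite leeD2l.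
  by rewrite sumS leeDr.
- rewrite [leRHS]addeC; apply: (@le_trans _ _ (state_integral 0 v +
    \sum_(k < n.+1) state_integral k.+1 v)); last by rewrite leeD2r.
  by rewrite -sumS leeDl.
Qed.

Let cost_occupation i n :
  (n.+1%:R^-1)%:E *
    \int[history_law pi zeta n.+1]_h \sum_(k < n.+1) cost M i (tnth h.1 k) =
  \int[occupation n]_z cost M i z.
Proof.
rewrite integral_history_law; [|exact: measurable_cost|exact: cost_ge0].
by rewrite integral_occupation; [|exact: measurable_cost|exact: cost_ge0].
Qed.

Lemma average_cost_lt i C : average_cost i pi zeta < C ->
  \forall n \near \oo, \int[occupation n]_z cost M i z <= C.
Proof.
move=> /ereal_inf_lt[_ [V [N _ NV] <-] supC].
near=> n; rewrite -cost_occupation; apply: le_trans (ltW supC).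
apply: ereal_sup_ubound; exists n.+1 => //; apply: NV => /=.
by apply: (leq_trans _ (leqnSn n)); near: n; exact: nbhs_infty_ge.
Unshelve. all: by end_near. Qed.

End history_laws.

Section stationary_cost.
Context (R : realType) dX dA (X : borelType dX) (A : borelType dA) (d : nat).
Variable M : cmdp R X A d.
Variables (mu : stationary_policy M) (p : probability X R).
Hypothesis inv : invariant_probability mu p.

Let pi := policy_of_stationary mu.
Let gamma := semidirect p (stationary_kernel mu).

Let stage_of_state n :
  (forall v, measurable_fun setT v -> (forall x, 0 <= v x) ->
    \int[history_law pi p n]_h v h.2 = \int[p]_x v x) ->
  forall f, measurable_fun setT f -> (forall z, 0 <= f z) ->
    \int[stage_law pi p n]_z f z = \int[gamma]_z f z.
Proof.
move=> state f mf f0.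
have mf_last : measurable_fun setT (f \o @last_pair _ _ X A n).
  exact: measurableT_comp mf (@measurable_last_pair _ _ X A n).
rewrite ge0_integral_distribution// integral_semidirect//; last first.
  by move=> z; exact: f0.
rewrite [RHS]integral_semidirect//.
pose v x := \int[stationary_kernel mu x]_a f (x, a).
rewrite -(state v)//; last by move=> x; exact: integral_ge0.
exact: measurable_fun_integral_finite_kernel.
Qed.

Let state_law n v : measurable_fun setT v -> (forall x, 0 <= v x) ->
  \int[history_law pi p n]_h v h.2 = \int[p]_x v x.
Proof.
elim: n v => [|n ih] v mv v0.
  rewrite ge0_integral_distribution//.
  exact: measurableT_comp mv measurable_snd.
rewrite -integral_stage_next// (stage_of_state ih); last 2 first.
- exact: measurable_next_integral.
- by move=> z; exact: integral_ge0.
exact: integral_next_invariant.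
Qed.

Lemma integral_stage_law_stationary n f : measurable_fun setT f ->
  (forall z, 0 <= f z) ->
  \int[stage_law pi p n]_z f z = \int[gamma]_z f z.
Proof. by move=> mf f0; apply: stage_of_state => //; exact: state_law. Qed.

Lemma average_cost_stationary i :
  average_cost i pi p = \int[gamma]_z cost M i z.
Proof.
have mc := measurable_cost M i; have c0 := cost_ge0 M i.
set c := \int[gamma]_z _.
suff : (n%:R^-1)%:E * \int[history_law pi p n]_h
    \sum_(k < n) cost M i (tnth h.1 k) @[n --> \oo] --> c.
  by move=> /cvg_limn_einf_sup[_ ].
apply: cvg_near_cst; near=> n.
have n0 : (0 < n)%N by near: n; exact: nbhs_infty_gt.
rewrite integral_history_law//.
rewrite (eq_bigr (fun=> 1 * c)) => [|k _]; last first.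
  by rewrite mul1e; exact: integral_stage_law_stationary.
rewrite -ge0_sume_distrl// sumEFin sumr_const card_ord.
rewrite muleA -EFinM mulVf ?mul1e//.
by rewrite pnatr_eq0 -lt0n.
Unshelve. all: by end_near. Qed.

End stationary_cost.

(** * Lexicographic minimization *)

Section lexicographic_order.
Context (R : realType) (N : nat).
Implicit Types x y : 'I_N -> \bar R.

Definition lex_le k x y : Prop :=
  (forall i : 'I_N, (i < k)%N -> x i = y i) \/
  (exists i : 'I_N, [/\ (i < k)%N, forall j : 'I_N, (j < i)%N -> x j = y j &
    x i < y i]).

(** The first coordinate where [x] and [y'] differ decides. *)
Lemma lex_le_trans x y y' : lex_le N x y -> (forall i, y i <= y' i) ->
  (forall i, x i = y' i) \/
  (exists i : 'I_N, (forall j : 'I_N, (j < i)%N -> x j = y' j) /\ x i < y' i).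
Proof.
move=> xy yy'; have [|/existsNP[i0 /eqP ne0]] := pselect (forall i, x i = y' i).
  by left.
case: (@arg_minnP _ i0 (fun i => x i != y' i)
  (@nat_of_ord N) ne0) => i ne min_i.
have eq_lt (j : 'I_N) : (j < i)%N -> x j = y' j.
  by move=> ji; apply/eqP; apply: contraTT ji => /min_i; rewrite -leqNgt.
right; exists i; split => //; rewrite lt_neqAle ne/=.
case: xy => [xy|[j [_ jlt xyj]]]; first by rewrite xy.
have [ij|ji|/val_inj ij] := ltngtP i j.
- by rewrite jlt.
- by have := lt_le_trans xyj (yy' j); rewrite eq_lt// ltxx.
- by rewrite ij; apply/ltW/(lt_le_trans xyj).
Qed.

End lexicographic_order.

Section lexicographic_minimum.
Context (R : realType) (T : Type) (N : nat) (F : set T).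
Variable J : 'I_N -> T -> \bar R.

Hypothesis F0 : F !=set0.
Hypothesis JF : forall i z, F z -> J i z \is a fin_num.
Hypothesis J_ge0 : forall i z, 0 <= J i z.
Hypothesis seq_limit : forall z : nat -> T, (forall n, F (z n)) ->
  exists w, F w /\
    forall i C, (\forall n \near \oo, J i (z n) <= C) -> J i w <= C.

(** Among the minimizers of the first [k] coordinates, a limit [w] of a sequence
    that minimizes the next coordinate is again such a minimizer: its first
    [k] coordinates cannot be smaller, and the limit does not increase them. *)
Lemma lexicographic_minimum k : (k <= N)%N ->
  exists z, F z /\ forall w, F w -> lex_le k (J^~ z) (J^~ w).
Proof.
elim: k => [_|k ih kN].
  by have [z Fz] := F0; exists z; split => // w _; left.
have [z [Fz zmin]] := ih (ltnW kN); pose o := Ordinal kN.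
pose Fk := [set w | F w /\ forall i : 'I_N, (i < k)%N -> J i w = J i z].
pose I := ereal_inf [set J o w | w in Fk].
have Ifin : I \is a fin_num.
  rewrite ge0_fin_numE; last by apply: le_ereal_inf_tmp => _ [w _ <-].
  apply: (@le_lt_trans _ _ (J o z)).
    by apply: ereal_inf_lbound; exists z.
  by have := JF o Fz; rewrite ge0_fin_numE.
have /choice[u uP] : forall n, exists w, Fk w /\ J o w < I + (n.+1%:R^-1)%:E.
  move=> n; have n0 : (0 < n.+1%:R^-1 :> R)%R by rewrite invr_gt0.
  by have [_ [w Fw <-] Jw] := lb_ereal_inf_adherent n0 Ifin; exists w.
have [w [Fw wlim]] := seq_limit (fun n => (uP n).1.1).
have wk (i : 'I_N) : (i < k)%N -> J i w <= J i z.
  by move=> ik; apply: wlim; apply: nearW => n; rewrite (uP n).1.2.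
have wI : J o w <= I.
  apply/lee_addgt0Pr => e e0; apply: wlim; near=> n.
  apply/ltW/(lt_le_trans (uP n).2); rewrite leeD2l// lee_fin ltW//.
  near: n; exact: near_infty_natSinv_lt (PosNum e0).
have Fkw : Fk w.
  split=> // i ik; have [->//|[j [jk jlt]]] := zmin _ Fw.
  by rewrite ltNge wk.
exists w; split => // v Fv.
have [vz|[i [ik ilt iv]]] := zmin _ Fv.
  have : J o w <= J o v.
    apply: le_trans wI _; apply: ereal_inf_lbound; exists v => //.
    by split => // i /vz.
  have eqk (i : 'I_N) : (i < k)%N -> J i w = J i v.
    by move=> ik; rewrite Fkw.2// vz.
  rewrite le_eqVlt => /orP[/eqP wv|wv]; [left|right].
    move=> i; rewrite ltnS leq_eqVlt => /orP[/eqP ik|]; last exact: eqk.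
    by rewrite (_ : i = o)//; exact: val_inj.
  by exists o; split.
right; exists i; split; first exact: ltnW.
  by move=> j ji; rewrite Fkw.2 ?ilt// (ltn_trans ji).
by rewrite Fkw.2.
Unshelve. all: by end_near. Qed.

End lexicographic_minimum.

Lemma eq_lee (R : realType) (x y : \bar R) : x = y -> x <= y.
Proof. by move=> ->. Qed.

Section stationary_optimality.
Context (R : realType) dX dA (X : borelType dX) (A : borelType dA) (d : nat).
Variable M : cmdp R X A d.
Variable Gam : nat -> set (X * A).
Hypotheses (MSU : conditionSU M Gam) (MM : conditionM M Gam).

Let pair := (stationary_policy M * probability X R)%type.
Let J (i : 'I_d.+1) (z : pair) := average_cost i (policy_of_stationary z.1) z.2.
Let gamma (z : pair) : probability (X * A)%type R :=
  semidirect z.2 (stationary_kernel z.1).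

Lemma stationary_limit (g : nat -> probability (X * A)%type R)
    (delta : nat -> R) :
  delta n @[n --> \oo] --> 0%R ->
  (forall n, near_invariant M (g n) (delta n)) ->
  (forall n, g n (admissible_graph M) = 1) ->
  (forall i, exists C : R, \forall n \near \oo, \int[g n]_z cost M i z <=
    C%:E) ->
  exists w : pair, stationary_pairs w /\ forall i C,
    (\forall n \near \oo, \int[g n]_z cost M i z <= C) -> J i w <= C.
Proof.
move=> delta0 g_near g_graph g_cost.
have [P [P1 Pinv Pcost]] :=
  limit_invariant_measure MSU MM delta0 g_near g_graph g_cost.
have [mu [p [inv Pmu]]] := invariant_disintegration P1 Pinv.
exists (mu, p); split; first exact: inv.
move=> i C iC; rewrite /J (average_cost_stationary inv) -Pmu; exact: Pcost.
Qed.

Lemma average_cost_ge0 i (pi : policy M) (zeta : probability X R) :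
  0 <= average_cost i pi zeta.
Proof.
apply: limf_esup_ge0 => [|n]; first exact: filter_not_empty.
rewrite mule_ge0 ?lee_fin//.
by apply: integral_ge0 => h _; apply: sume_ge0 => k _; exact: cost_ge0.
Qed.

Lemma feasible_fin_num (pi : policy M) (zeta : probability X R) i :
  feasible (pi, zeta) -> average_cost i pi zeta \is a fin_num.
Proof.
move=> [fe0 fe]; rewrite ge0_fin_numE; last exact: average_cost_ge0.
have [j ->|->] := unliftP ord0 i; last exact: fe0.
exact: le_lt_trans (fe j) (ltry _).
Qed.

(** For [e > 0] the mean cost under the occupation measures is eventually at
    most the average cost plus [e], by definition of the limit superior. *)
Lemma stationary_improvement (pi : policy M) (zeta : probability X R) :
  feasible (pi, zeta) -> exists w : pair, stationary_pairs w /\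
    forall i, J i w <= average_cost i pi zeta.
Proof.
move=> fe; have Jfin i := feasible_fin_num i fe.
have near_cost i e : (0 < e)%R ->
    \forall n \near \oo, \int[occupation pi zeta n]_z cost M i z <=
      average_cost i pi zeta + e%:E.
  by move=> e0; apply: average_cost_lt; rewrite lteDl.
have [||||w [inv wC]] := @stationary_limit (fun n => occupation pi zeta n)
    (fun n => n.+1%:R^-1)%R.
- exact: cvg_harmonic.
- by move=> n; exact: near_invariant_occupation.
- by move=> n; exact: occupation_graph.
- move=> i; exists (fine (average_cost i pi zeta) + 1)%R.
  by rewrite EFinD fineK//; exact: near_cost.
exists w; split; first exact: inv.
move=> i; apply/lee_addgt0Pr => e e0; apply: wC; exact: near_cost.
Qed.

Lemma stationary_sequence_limit (z : nat -> pair) :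
  (forall n, stationary_pairs (z n)) ->
  (forall i, exists C : R, forall n, J i (z n) <= C%:E) ->
  exists w : pair, stationary_pairs w /\ forall i C,
    (\forall n \near \oo, J i (z n) <= C) -> J i w <= C.
Proof.
move=> inv zC.
have JE i n : J i (z n) = \int[gamma (z n)]_x cost M i x.
  exact: (average_cost_stationary (inv n) i).
have [||||w [winv wC]] := @stationary_limit (fun n => gamma (z n)) (fun=> 0%R).
- exact: cvg_cst.
- by move=> n; exact: (near_invariant_stationary (inv n)).
- by move=> n; exact: semidirect_graph.
- by move=> i; have [C zCi] := zC i; exists C; apply: nearW => n; rewrite -JE.
exists w; split; first exact: winv.
by move=> i C nC; apply: wC; apply: filterS nC => n; rewrite JE.
Qed.

Lemma stationary_feasible (w : pair) (pi : policy M) (zeta : probability X R) :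
  feasible (pi, zeta) -> (forall i, J i w <= average_cost i pi zeta) ->
  feasible (policy_of_stationary w.1, w.2).
Proof.
move=> [fe0 fe] wJ; split; first exact: le_lt_trans (wJ _) fe0.
by move=> i; exact: le_trans (wJ _) (fe i).
Qed.

Lemma stationary_lex_optimal : conditionG M ->
  exists w : pair, [/\ stationary_pairs w,
    feasible (policy_of_stationary w.1, w.2) &
    lex_optimal (policy_of_stationary w.1, w.2)].
Proof.
move=> [[pi zeta] fe]; have [w0 [inv0 w0J]] := stationary_improvement fe.
have w0fe := stationary_feasible fe w0J.
(* The costs of [w0] and the limits [kappa] bound the costs along minimizing
   sequences, which tightness requires. *)
pose K i : R := if unlift ord0 i is Some j then kappa M j else fine (J ord0 w0).
pose F := [set z : pair | stationary_pairs z /\ forall i, J i z <= (K i)%:E].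
have F_feasible z : F z -> feasible (policy_of_stationary z.1, z.2).
  move=> [_ zK]; split => [|i]; first exact: le_lt_trans (zK ord0) (ltry _).
  by have := zK (lift ord0 i); rewrite /K liftK.
have feasible_F z : stationary_pairs z ->
    feasible (policy_of_stationary z.1, z.2) -> J ord0 z <= J ord0 w0 -> F z.
  move=> inv [_ zfe] z0; split; first exact: inv.
  move=> i; rewrite /K.
  case: unliftP => [j ->|->]; first exact: zfe.
  by rewrite fineK; [exact: z0|exact: feasible_fin_num w0fe].
have [||||w [Fw wmin]] := @lexicographic_minimum R pair d.+1 F J _ _ _ _ d.+1
  (leqnn _).
- by exists w0; exact: feasible_F inv0 w0fe (lexx _).
- by move=> i z Fz; exact: feasible_fin_num (F_feasible _ Fz).
- by move=> i z; exact: average_cost_ge0.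
- move=> z Fz; have [||w [winv wC]] := stationary_sequence_limit (z := z).
  + by move=> n; have [] := Fz n.
  + by move=> i; exists (K i) => n; have [_] := Fz n; exact.
  exists w; split; last exact: wC.
  split; first exact: winv.
  move=> i; apply: wC; apply: nearW => n.
  by have [_] := Fz n; exact.
have K0 : K ord0 = fine (J ord0 w0) by rewrite /K unlift_none.
have wJ0 : J ord0 w <= J ord0 w0.
  rewrite -[leRHS]fineK; last exact: feasible_fin_num w0fe.
  by rewrite -K0; exact: Fw.2.
have lex (v : policy M * probability X R) : feasible v ->
    (forall i, J i w = average_cost i v.1 v.2) \/
    (exists i : 'I_d.+1, (forall j : 'I_d.+1, (j < i)%N ->
      J j w = average_cost j v.1 v.2) /\ J i w < average_cost i v.1 v.2).
  move: v => [pi' zeta'] fe'; have [v [vinv vJ]] := stationary_improvement fe'.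
  have [le0|nle0] := pselect (J ord0 v <= J ord0 w0).
    apply: (lex_le_trans (y := J^~ v)); last exact: vJ.
    exact/wmin/(feasible_F _ vinv (stationary_feasible fe' vJ) le0).
  right; exists ord0; split.
    by move=> j j0; exfalso; rewrite ltn0 in j0.
  have lt0 : J ord0 w0 < J ord0 v by rewrite ltNge; exact/negP.
  exact: le_lt_trans wJ0 (lt_le_trans lt0 (vJ ord0)).
have wfe := F_feasible _ Fw; have [winv _] := Fw.
exists w; split; [exact: winv|exact: wfe|split; [split;
  [exact: wfe|]|exact: lex]].
apply/eqP; rewrite eq_le; apply/andP; split.
  apply: le_ereal_inf_tmp => _ [v /lex[eqv|[i [eqv ltv]]] <-].
    exact: eq_lee (eqv ord0).
  have [i0|i0] := posnP i; last exact: eq_lee (eqv ord0 i0).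
  have <- : i = ord0 by exact/val_inj.
  exact: ltW ltv.
apply: ereal_inf_lbound.
by exists (policy_of_stationary w.1, w.2); first exact: wfe.
Qed.

End stationary_optimality.

Theorem theorem4p1 (R : realType) (dX dA : measure_display)
    (X : borelType dX) (A : borelType dA) (d : nat) (M : cmdp R X A d)
    (Gam : nat -> set (X * A)) :
  conditionG M -> conditionSU M Gam -> conditionM M Gam ->
  [/\ forall (pi : policy M) (zeta : probability X R), feasible (pi, zeta) ->
        exists (mu : stationary_policy M) (p : probability X R),
          [/\ stationary_pairs (mu, p),
              feasible (policy_of_stationary mu, p) &
              forall i : 'I_d.+1,
                average_cost i (policy_of_stationary mu) p
                  <= average_cost i pi zeta],
      exists (mu : stationary_policy M) (p : probability X R),
        [/\ stationary_pairs (mu, p),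
            feasible (policy_of_stationary mu, p) &
            optimal (policy_of_stationary mu, p)] &
      exists (mu : stationary_policy M) (p : probability X R),
        [/\ stationary_pairs (mu, p),
            feasible (policy_of_stationary mu, p) &
            lex_optimal (policy_of_stationary mu, p)]].
Proof.
move=> MG MSU MM.
have [[mu p] [inv fe lex]] := stationary_lex_optimal MSU MM MG.
split; [|exists mu, p; split; [exact: inv|exact: fe|exact: lex.1]
  |exists mu, p; split; [exact: inv|exact: fe|exact: lex]].
move=> pi zeta fe'.
have [[mu' p'] [inv' le']] := stationary_improvement MSU MM fe'.
exists mu', p'; split; [exact: inv'| |exact: le'].
exact: stationary_feasible fe' le'.
Qed.
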